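(* Let $(\mathbf d_n)_{n\ge1}$ be a family of degree sequences and $v_n\in[n]$. Assume, as $n\to\infty$, \[\sigma^2(\mathbf d_n)=o\Big(\frac{n}{(\log n)^3}\Big),\qquad \sigma^2(\mathbf d_n)=\omega(n^{-1}),\qquad \Delta(\mathbf d_n)=o\Big(\sqrt{\frac{n\sigma^2(\mathbf d_n)}{(\log n)^3}}\Big).\] Let $X$ be standard Rayleigh distributed ($\mathbb P(X>x)=e^{-x^2/2}$, $x>0$). Then for every $p\ge1$, \[\lim_{n\to\infty}\mathbb E\Big[\Big(\frac{\mathfrak s_n(v_n)}{\sqrt{n/\sigma^2(\mathbf d_n)}}\Big)^p\Big]=\mathbb E[X^p].\] In particular $\mathbb E[\mathfrak s_n(v_n)]\sim\sqrt{\pi n/(2\sigma^2(\mathbf d_n))}$ and $\mathrm{Var}(\mathfrak s_n(v_n))\sim\frac{(4-\pi)n}{2\sigma^2(\mathbf d_n)}$.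
   Context: A degree sequence is $\mathbf d_n=(d_{n,1},\ldots,d_{n,n})\in\mathbb N_0^n$ with $\sum_j d_{n,j}=n$. For such a sequence let $\mathfrak F(\mathbf d_n)=\{f:[n]\to[n]: |f^{-1}(\{i\})|=d_{n,i}\ \forall i\in[n]\}$; a random functional graph with degree sequence $\mathbf d_n$ is the graph with edges $\{(v,F(v))\}$ where $F$ is uniform on $\mathfrak F(\mathbf d_n)$. For $f:V\to V$ and $v\in V$, the six-length is $\mathfrak s_f(v)=\min\{k\in\mathbb N: f^{(k)}(v)\in\{f^{(j)}(v):0\le j\le k-1\}\}$ ($f^{(k)}$ the $k$-fold composition, $f^{(0)}=\mathrm{id}$); $\mathfrak s_n(v)$ denotes $\mathfrak s_F(v)$ for $F$ uniform on $\mathfrak F(\mathbf d_n)$. Notation: $\Delta(\mathbf d_n)=\max_j d_{n,j}$, $m_k(\mathbf d_n)=\sum_j d_{n,j}^k$, $\sigma^2(\mathbf d_n)=m_2(\mathbf d_n)/n-1$. $a_n=\omega(b_n)$ means $b_n=o(a_n)$. *)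

(* Defs.v *)
From Stdlib Require Import Reals Lra Lia Arith List.
Import ListNotations.
Open Scope R_scope.

(* A map f : [n] -> [n] is encoded as the list [f 0; ...; f (n-1)]. *)
Definition fapp (f : list nat) (x : nat) : nat := nth x f 0%nat.
Definition fiter (f : list nat) (k x : nat) : nat := Nat.iter k (fapp f) x.

Fixpoint all_lists (k n : nat) : list (list nat) :=
  match k with
  | O => [[]]
  | S k' => flat_map (fun l => map (fun a => a :: l) (seq 0 n)) (all_lists k' n)
  end.

Definition all_maps (n : nat) : list (list nat) := all_lists n n.

Definition has_degrees (n : nat) (dn : nat -> nat) (f : list nat) : bool :=
  forallb (fun i => Nat.eqb (count_occ Nat.eq_dec f i) (dn i)) (seq 0 n).

Definition Fd (n : nat) (dn : nat -> nat) : list (list nat) :=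
  filter (has_degrees n dn) (all_maps n).

Definition revisits (f : list nat) (v k : nat) : bool :=
  existsb (fun j => Nat.eqb (fiter f k v) (fiter f j v)) (seq 0 k).

Fixpoint first_true (P : nat -> bool) (start fuel : nat) : option nat :=
  match fuel with
  | O => None
  | S fuel' => if P start then Some start else first_true P (S start) fuel'
  end.

(* six-length s_f(v) = min{k >= 1 : f^(k)(v) in {f^(j)(v) : j < k}}.
   For f : [n] -> [n] and v in [n] the minimum is attained at some k <= n,
   so searching k = 1, ..., n+1 finds the true minimum. *)
Definition sixlen (n : nat) (f : list nat) (v : nat) : nat :=
  match first_true (revisits f v) 1 (S n) with
  | Some k => k
  | None => 0%nat
  end.

Definition nsum (l : list nat) : nat := fold_right Nat.add 0%nat l.
Definition is_degree_sequence (n : nat) (dn : nat -> nat) : Prop :=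
  nsum (map dn (seq 0 n)) = n.
Definition maxdeg (n : nat) (dn : nat -> nat) : nat := list_max (map dn (seq 0 n)).
Definition m2 (n : nat) (dn : nat -> nat) : nat := nsum (map (fun j => dn j * dn j)%nat (seq 0 n)).
Definition sigma2 (n : nat) (dn : nat -> nat) : R := INR (m2 n dn) / INR n - 1.

Definition rsum (l : list R) : R := fold_right Rplus 0 l.
Definition expect_s (n : nat) (dn : nat -> nat) (v : nat) (g : nat -> R) : R :=
  rsum (map (fun f => g (sixlen n f v)) (Fd n dn)) / INR (length (Fd n dn)).

(* x^p for x >= 0 and real p > 0 (0^p = 0) *)
Definition rpow (x p : R) : R := if Rle_dec x 0 then 0 else Rpower x p.

(* density of the standard Rayleigh law: P(X > x) = exp(-x^2/2), x > 0 *)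
Definition rayleigh_density (x : R) : R := x * exp (- (x * x) / 2).

Definition improper_int0 (f : R -> R) (l : R) : Prop :=
  (forall M, 0 <= M -> inhabited (Riemann_integrable f 0 M)) /\
  (forall eps, 0 < eps -> exists M0, forall M (pr : Riemann_integrable f 0 M),
      M0 <= M -> Rabs (RiemannInt pr - l) < eps).

Definition rayleigh_moment (p l : R) : Prop :=
  improper_int0 (fun x => rpow x p * rayleigh_density x) l.

Definition little_o (a b : nat -> R) : Prop :=
  forall eps, 0 < eps -> exists N, forall n, (N <= n)%nat -> Rabs (a n) <= eps * Rabs (b n).

(* Main.v *)
(* The event [s > k] says that [v, f v, ..., f^k v] are distinct.  Unassigned positions of
   the uniform map are exchangeable, so this event has probability [q k = e_k(d') / C(n,k)],
   where [e_k] is the elementary symmetric polynomial and [d'] is [d] with the entry at [v]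
   set to 0.  Mixing [k] over the binomial law with parameters [n] and [th] gives the product
   [\prod_i (1 + (d'_i - 1) th)], which at [th = x / sqrt (n sigma^2)] is close to
   [exp (- x^2 / 2)] by a second order expansion.  Since [q] is decreasing, Chebyshev's
   inequality transfers this limit to [q k] for [k ~ x sqrt (n / sigma^2)], and Markov's
   inequality gives an exponential tail bound for [q] on the same scale.  The moments then
   converge by uniform convergence on compacts and domination of the tail. *)
Require Import Defs.
From mathcomp Require all_boot zify.
From Stdlib Require Import Reals Lra Lia Arith ZArith List.
From Coquelicot Require Import Coquelicot.
Open Scope R_scope.

(** * Counting maps through elementary symmetric polynomials *)

(** Estimating the single ratio e_k(d') / C(n,k) directly would require control of one coefficient
    of a generating function. The whole product is easier: it factorises over vertices, and its
    logarithm is governed by two power sums of d'_i - 1. As the degrees sum to n, the first is only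
    - d_v, and the second is n sigma^2 up to at most 1 + D^2, with D the maximal degree. At th = x /
    sqrt (n sigma^2) the quadratic term is x^2 / 2, the Rayleigh exponent, and D = o(sqrt (n
    sigma^2)) removes the other terms. The price is the return from the mixture to one k. Binomial
    means (1 - eta) k and (1 + eta) k with eta = k^(-1/4) lie k^(3/4) away from k, beyond the
    standard deviation of order sqrt k, and are still asymptotic to k. For domination any fixed
    exponential rate on the scale sqrt (n / sigma^2) is enough, so there the cruder mean k / 2
    serves. *)

Fixpoint elsym (l : list nat) (k : nat) : nat :=
  match k, l with
  | O, _ => 1
  | S _, nil => 0
  | S k', a :: l' => elsym l' k + a * elsym l' k'
  end.

Lemma elsym0 (l : list nat) : elsym l 0 = 1%nat.
Proof. now destruct l. Qed.

Module Counting.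
Import all_boot zify.
Local Open Scope nat_scope.

Lemma elsym_cons a l k : elsym (a :: l) k.+1 = elsym l k.+1 + a * elsym l k.
Proof. by []. Qed.

Lemma elsym_cons0 l k : elsym (0 :: l) k = elsym l k.
Proof. by case: k => [|k]; rewrite ?elsym0 // elsym_cons mul0n addn0. Qed.

Lemma elsym_ones n k : elsym (nseq n 1) k = 'C(n, k).
Proof.
elim: n k => [|n IHn] [|k]; rewrite ?elsym0 ?bin0 //.
by rewrite /nseq -/(nseq n 1) elsym_cons !IHn mul1n binS.
Qed.

(** Euler's identity for a homogeneous polynomial of degree [k.+1]: zeroing the entry at [w] yields
    the partial derivative in that variable. [uniq l] makes the mask hit a single position. *)
Lemma elsym_euler (g : nat -> nat) (l : seq nat) (k : nat) : uniq l ->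
  k.+1 * elsym [seq g i | i <- l] k.+1 =
  \sum_(w <- l) g w * elsym [seq (if i == w then 0 else g i) | i <- l] k.
Proof.
elim: l k => [|a l IHl] k; first by rewrite big_nil muln0.
rewrite cons_uniq => /andP[a_l uniq_l].
rewrite big_cons !map_cons eqxx elsym_cons0 elsym_cons.
have -> : [seq (if i == a then 0 else g i) | i <- l] = [seq g i | i <- l].
  apply/eq_in_map => i i_l; case: eqP => // ia.
  by rewrite -ia i_l in a_l.
have step w : w \in l -> (a == w) = false.
  by move=> w_l; apply/eqP => aw; rewrite aw w_l in a_l.
case: k => [|k].
  under eq_bigr => w _ do rewrite elsym0 muln1.
  have := IHl 0 uniq_l; under eq_bigr => w _ do rewrite elsym0 muln1.
  by rewrite !mul1n !elsym0 !muln1 => ->; rewrite addnC.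
(* For [w] in [l] the head [g a] survives the mask. Expanding along it gives two sums that the
   induction hypothesis evaluates in consecutive degrees. *)
rewrite (eq_big_seq (fun w =>
    g w * elsym [seq (if i == w then 0 else g i) | i <- l] k.+1 +
    g a * (g w * elsym [seq (if i == w then 0 else g i) | i <- l] k))); last first.
  by move=> w w_l; rewrite map_cons (step w w_l) elsym_cons mulnDr [in RHS]mulnCA.
rewrite big_split /= -big_distrr /= -!IHl //.
by rewrite mulnDr mulnCA [k.+2 * elsym _ k.+1]mulSn mulnDr; lia.
Qed.

Lemma InP (T : eqType) (x : T) (s : seq T) : List.In x s <-> x \in s.
Proof.
elim: s => [|y s IHs] //=; rewrite in_cons; split.
  by case=> [-> | /IHs ->]; rewrite ?eqxx ?orbT.
by case/orP => [/eqP-> | /IHs]; [left | right].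
Qed.

Lemma all_listsS k n : all_lists k.+1 n =
  flatten [seq [seq a :: l | a <- iota 0 n] | l <- all_lists k n].
Proof. by rewrite /=; elim: (all_lists k n) => //= l s ->. Qed.

Lemma all_lists_uniq k n : uniq (all_lists k n).
Proof.
elim: k => [|k IHk] //; rewrite all_listsS.
apply: allpairs_uniq => //; first exact: iota_uniq.
by move=> [l a] [l' a'] _ _ [-> ->].
Qed.

Lemma mem_all_lists k n l :
  (l \in all_lists k n) = (size l == k) && all (gtn n) l.
Proof.
elim: k l => [|k IHk] l; first by case: l.
rewrite all_listsS; apply/allpairsP/idP => /= [[[l' a] [/= l'_in a_in ->]]|].
  by move: l'_in a_in; rewrite IHk mem_iota add0n /= eqSS => /andP[-> ->] ->.
case: l => [|a l] //=; rewrite eqSS => /and3P[sz a_lt l_lt].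
by exists (l, a); rewrite /= IHk sz l_lt mem_iota.
Qed.

Lemma count_occE l i : List.count_occ PeanoNat.Nat.eq_dec l i = count_mem i l.
Proof.
elim: l => [|a l IHl] //=; case: PeanoNat.Nat.eq_dec => [->|/eqP/negbTE ai].
  by rewrite eqxx IHl.
by rewrite ai IHl.
Qed.

Lemma mem_Fd n d f : (f \in Fd n d) =
  [&& size f == n, all (gtn n) f & all (fun i => count_mem i f == d i) (iota 0 n)].
Proof.
rewrite /Fd -[List.filter _ _]/(filter (has_degrees n d) (all_maps n)).
rewrite mem_filter mem_all_lists andbC -andbA; congr [&& _, _ & _].
rewrite /has_degrees -[List.forallb _ _]/(all _ (iota 0 n)).
apply: eq_all => i; rewrite count_occE.
by apply/idP/eqP => [/PeanoNat.Nat.eqb_eq|->] //; apply: PeanoNat.Nat.eqb_refl.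
Qed.

Lemma Fd_uniq n d : uniq (Fd n d).
Proof. exact/filter_uniq/all_lists_uniq. Qed.

Lemma Fd_size n d f : f \in Fd n d -> size f = n.
Proof. by rewrite mem_Fd => /and3P[/eqP]. Qed.

Lemma fappE f x : fapp f x = nth 0 f x.
Proof. by rewrite /fapp; elim: f x => [|a f IHf] [|x] //=. Qed.

Lemma Fd_lt n d f x : f \in Fd n d -> x < n -> fapp f x < n.
Proof.
rewrite mem_Fd fappE => /and3P[/eqP <- /allP lt_n _] x_n.
exact/lt_n/mem_nth.
Qed.

Lemma Fd_count n d f i : f \in Fd n d -> i < n -> count_mem i f = d i.
Proof.
rewrite mem_Fd => /and3P[_ _ /allP cnt] i_n.
by apply/eqP/cnt; rewrite mem_iota.
Qed.

(** The witness lists [d 0] zeros, then [d 1] ones, and so on; the degree condition makes its length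
    [n]. *)
Lemma Fd_neq0 n d : is_degree_sequence n d -> 0 < size (Fd n d).
Proof.
move=> degd; suff: flatten [seq nseq (d i) i | i <- iota 0 n] \in Fd n d.
  by case: (Fd n d).
rewrite mem_Fd size_flatten /shape -map_comp; apply/and3P; split.
- rewrite -[X in _ == X]degd; apply/eqP; congr foldr.
  by apply: eq_map => i /=; rewrite size_nseq.
- apply/allP => x /flattenP[s /mapP[i i_n ->]] /nseqP[-> _].
  by move: i_n; rewrite mem_iota.
apply/allP => i i_n; rewrite count_flatten -map_comp.
rewrite (eq_map (g := fun j => (j == i) * d j)); last first.
  by move=> j /=; rewrite count_nseq /=.
have cnt1 : count_mem i (iota 0 n) = 1 by rewrite count_uniq_mem ?iota_uniq // i_n.
apply/eqP; rewrite -[RHS]mul1n -cnt1.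
by elim: (iota 0 n) => //= j s ->; case: eqP => [->|_]; rewrite ?mul0n // mulnDl.
Qed.

(** * Exchangeability of positions under transpositions *)

Definition swap (x y i : nat) := if i == x then y else if i == y then x else i.

Lemma swapK x y : involutive (swap x y).
Proof.
move=> i; rewrite /swap; have [->|ix] := eqVneq i x.
  by rewrite eqxx; case: eqP.
have [->|iy] := eqVneq i y; first by rewrite eqxx.
by rewrite (negbTE ix) (negbTE iy).
Qed.

Lemma swap_lt n x y i : x < n -> y < n -> i < n -> swap x y i < n.
Proof. by rewrite /swap; do 2?case: eqP. Qed.

Definition swapf (n x y : nat) (f : seq nat) :=
  [seq fapp f (swap x y i) | i <- iota 0 n].

Lemma fapp_swapf n x y f i : i < n -> fapp (swapf n x y f) i = fapp f (swap x y i).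
Proof.
by move=> i_n; rewrite fappE (nth_map 0) ?size_iota // nth_iota.
Qed.

Lemma swapf_Fd n d x y f : x < n -> y < n -> f \in Fd n d -> swapf n x y f \in Fd n d.
Proof.
move=> x_n y_n f_Fd; have sz := Fd_size _ _ _ f_Fd.
have perm_f : perm_eq (swapf n x y f) f.
  rewrite /swapf (map_comp (fapp f)).
  apply: (@perm_trans _ [seq fapp f i | i <- iota 0 n]).
    apply/perm_map/uniq_perm; rewrite ?iota_uniq //.
      by rewrite map_inj_uniq ?iota_uniq //; apply/inv_inj/swapK.
    move=> i; apply/mapP/idP => [[j] |].
      by rewrite !mem_iota /= => j_n ->; apply: swap_lt.
    rewrite mem_iota /= => i_n; exists (swap x y i); last by rewrite swapK.
    by rewrite mem_iota; apply: swap_lt.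
  by rewrite (eq_map (fappE f)) -sz map_nth_iota0 // take_size.
move: f_Fd; rewrite !mem_Fd (perm_size perm_f) (perm_all _ perm_f).
by move=> /and3P[-> -> /allP cnt]; apply/allP => i /cnt; rewrite (permP perm_f).
Qed.

Lemma swapfK n d x y f : x < n -> y < n -> f \in Fd n d -> swapf n x y (swapf n x y f) = f.
Proof.
move=> x_n y_n f_Fd; have sz := Fd_size _ _ _ f_Fd.
apply: (@eq_from_nth _ 0); rewrite ?size_map ?size_iota // => i i_n.
by rewrite -!fappE !fapp_swapf ?swapK //; apply: swap_lt.
Qed.

(** Swapping two positions only permutes the list of values, so [swapf n x y] is an involution of
    [Fd n d]. *)
Lemma count_swapf n d x y (P : pred (seq nat)) : x < n -> y < n ->
  count P (Fd n d) = count (fun f => P (swapf n x y f)) (Fd n d).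
Proof.
move=> x_n y_n; rewrite -(count_map (swapf n x y) P); apply/permP/uniq_perm.
- exact: Fd_uniq.
- rewrite map_inj_in_uniq ?Fd_uniq // => f g f_in g_in fg.
  by rewrite -(swapfK n d x y f) // fg (swapfK n d).
move=> f; apply/idP/mapP => [f_in|[g g_in ->]]; last exact: swapf_Fd.
by exists (swapf n x y f); rewrite ?swapf_Fd // (swapfK n d).
Qed.

(* [x :: U] is the trajectory of [f] listed backwards from its current end [x]. *)
Definition follows (f : seq nat) (x : nat) (U : seq nat) : bool :=
  path (fun a b => fapp f b == a) x U.

Lemma follows_ext f g x U : {in U, fapp f =1 fapp g} -> follows f x U = follows g x U.
Proof.
rewrite /follows; elim: U x => [|y U IHU] x //= fg.
rewrite fg ?inE ?eqxx // IHU // => z z_U.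
by apply: fg; rewrite inE z_U orbT.
Qed.

Lemma follows_mem f x U y : follows f x U -> y \in U -> fapp f y \in x :: U.
Proof.
rewrite /follows; elim: U x => [|z U IHU] x //= /andP[/eqP fz fU].
rewrite inE => /orP[/eqP->|y_U]; first by rewrite fz inE eqxx.
by rewrite in_cons (IHU z fU y_U) orbT.
Qed.

Definition nfollow n d x U := count (fun f => follows f x U) (Fd n d).

Lemma count_sum (T : Type) (P : pred T) (s : seq T) : count P s = \sum_(f <- s) P f.
Proof. by rewrite -sum1_count big_mkcond; apply: eq_bigr => f _; case: (P f). Qed.

(* Given the values along the trajectory, the [n - size U] unassigned positions
   are exchangeable, and exactly [d w] of them are mapped to [w]. *)
Lemma nfollow_step n d x U w : uniq (x :: U) -> all (gtn n) (x :: U) ->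
  w < n -> w \notin x :: U ->
  (n - size U) * nfollow n d w (x :: U) = d w * nfollow n d x U.
Proof.
move=> /= /andP[x_U uniq_U] /andP[x_n U_n] w_n w_U.
pose free := [seq y <- iota 0 n | y \notin U].
have size_free : size free = n - size U.
  have := count_predC (mem U) (iota 0 n); rewrite size_iota -size_filter.
  have -> : size [seq y <- iota 0 n | y \in U] = size U.
    apply/perm_size/uniq_perm; rewrite ?filter_uniq ?iota_uniq // => y.
    rewrite mem_filter mem_iota add0n /=.
    by case: (boolP (y \in U)) => //= /(allP U_n) /= ->.
  by move=> <-; rewrite addKn /free size_filter.
(* Swapping [x] and [y] turns the condition on the image of [y] into one on the image of [x]; the
   values on [U] stay fixed because neither point lies in [U]. *)
have same y : y \in free ->
    count (fun f => follows f x U && (fapp f y == w)) (Fd n d) = nfollow n d w (x :: U).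
  rewrite mem_filter mem_iota /= add0n => /andP[y_U y_n].
  rewrite (count_swapf n d x y) // /nfollow; apply: eq_in_count => f f_in.
  rewrite /follows /= -/(follows _ _ _) -/(follows f x U) andbC fapp_swapf //.
  have -> : swap x y y = x by rewrite /swap eqxx; case: eqP.
  congr (_ && _).
  apply: follows_ext => z z_U; rewrite fapp_swapf; last exact: (allP U_n).
  rewrite /swap; case: eqP => [zx|_]; first by rewrite -zx z_U in x_U.
  by case: eqP => [zy|//]; rewrite -zy z_U in y_U.
have -> : (n - size U) * nfollow n d w (x :: U) =
    \sum_(y <- free) count (fun f => follows f x U && (fapp f y == w)) (Fd n d).
  by rewrite (eq_big_seq _ same) big_const_seq count_predT size_free iter_addn_0 mulnC.
under eq_bigr do rewrite count_sum.
(* Double counting: for a fixed map that follows the trajectory, count the free positions sent to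
   [w]. *)
rewrite exchange_big /= /nfollow count_sum big_distrr /=.
apply: eq_big_seq => f f_in; case: (boolP (follows f x U)) => fU; last first.
  by rewrite big1 // muln0.
rewrite muln1 -count_sum /free count_filter -(Fd_count n d f w f_in w_n).
have fE : f = [seq fapp f i | i <- iota 0 n].
  by rewrite (eq_map (fappE f)) -(Fd_size _ _ _ f_in) map_nth_iota0 // take_size.
rewrite {2}fE count_map; apply: eq_in_count => y _ /=.
(* A map that follows the trajectory sends [U] into [x :: U], which misses [w]; hence all [d w]
   preimages of [w] are free. *)
case: eqP => //= fy; apply/negP => /(follows_mem _ _ _ _ fU).
by rewrite fy (negbTE w_U).
Qed.

(** [U] accumulates the visited points, latest first, so conditioning on one more step stays in the
    same family of events. With [U] empty this becomes the event that the six-length exceeds [m]. *)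
Fixpoint fresh (m : nat) (f : seq nat) (x : nat) (U : seq nat) : bool :=
  if m is m'.+1 then (fapp f x \notin x :: U) && fresh m' f (fapp f x) (x :: U)
  else true.

Definition erase (d : nat -> nat) (n : nat) (U : seq nat) :=
  [seq (if i \in U then 0 else d i) | i <- iota 0 n].

(** Induction on [m] by conditioning on the next point [w]: [nfollow_step] contributes the factor
    [d w] over [n - size U], and [elsym_euler] reassembles the sum over [w]. Keeping the products on
    both sides avoids division, and a general [U] is what the induction needs. *)
Lemma count_fresh n d m x U : uniq (x :: U) -> all (gtn n) (x :: U) ->
  count (fun f => follows f x U && fresh m f x U) (Fd n d) * 'C(n - size U, m) =
  nfollow n d x U * elsym (erase d n (x :: U)) m.
Proof.
elim: m x U => [|m IHm] x U uniq_xU lt_n.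
  rewrite bin0 elsym0 !muln1; apply: eq_count => f.
  by rewrite /= andbT.
have x_n : x < n by case/andP: lt_n.
have U_n : size (x :: U) <= n.
  rewrite -[n in leqRHS](size_iota 0); apply: uniq_leq_size => // y /(allP lt_n).
  by rewrite mem_iota.
have split_next : count (fun f => follows f x U && fresh m.+1 f x U) (Fd n d) =
    \sum_(w <- iota 0 n | w \notin x :: U)
      count (fun f => follows f w (x :: U) && fresh m f w (x :: U)) (Fd n d).
  rewrite count_sum; under [RHS]eq_bigr do rewrite count_sum.
  rewrite exchange_big; apply: eq_big_seq => f f_in.
  (* For each map only the term [w = fapp f x] can be nonzero. *)
  rewrite (big_rem (fapp f x)) ?mem_iota ?add0n ?(Fd_lt _ _ _ _ f_in) //=.
  rewrite big1_seq => [|w /andP[_]]; last first.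
    rewrite mem_rem_uniq ?iota_uniq // inE /follows /= => /andP[/negbTE].
    by rewrite eq_sym => ->.
  by rewrite addn0 /follows /= eqxx; case: (_ \notin _); rewrite ?andbF.
have masked w : w \notin x :: U ->
    [seq (if i == w then 0 else if i \in x :: U then 0 else d i) | i <- iota 0 n] =
    erase d n (w :: x :: U).
  by move=> w_U; apply: eq_map => i; rewrite [in RHS]inE; case: eqP.
(* The factor [m.+1] serves both sides: it lowers the binomial coefficient through [mul_bin_diag]
   and is the degree in Euler's identity. *)
apply/eqP; rewrite -(eqn_pmul2l (ltn0Sn m)) mulnCA -mul_bin_diag.
rewrite [m.+1 * (nfollow _ _ _ _ * _)]mulnCA elsym_euler ?iota_uniq // split_next.
rewrite mulnA big_distrl /= big_distrl big_distrr /= [X in _ == X]big_mkcond /=.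
rewrite [X in X == _]big_mkcond /=; apply/eqP/eq_big_seq => w.
rewrite mem_iota add0n /= => w_n; case: (boolP (w \in x :: U)) => w_U /=.
  by rewrite mul0n muln0.
rewrite masked // -mulnA -subnS -[(size U).+1]/(size (x :: U)).
rewrite mulnCA IHm ?mulnA; last 2 first.
- by rewrite cons_uniq w_U.
- by rewrite /= w_n; exact: lt_n.
by rewrite nfollow_step // [d w * _]mulnC.
Qed.

(** Pigeonhole: the old and new points of a fresh trajectory are distinct elements of [n]. *)
Lemma fresh_bound n d m f x U : f \in Fd n d -> uniq (x :: U) -> all (gtn n) (x :: U) ->
  fresh m f x U -> size U + m < n.
Proof.
move=> f_in; elim: m x U => [|m IHm] x U uniq_xU lt_n.
  move=> _; rewrite addn0 -[n in leqRHS](size_iota 0) -[_.+1]/(size (x :: U)).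
  by apply: uniq_leq_size => // y /(allP lt_n); rewrite mem_iota.
move=> /= /andP[fx_U /IHm]; rewrite addSnnS; apply.
  by rewrite cons_uniq fx_U.
by move: (lt_n) => /andP[x_n _]; apply/andP; split; first exact: Fd_lt f_in _.
Qed.

(** * From fresh trajectories to the six-length *)

Lemma revisitsE f v k : revisits f v k = (fiter f k v \in [seq fiter f j v | j <- iota 0 k]).
Proof.
apply/idP/mapP => [|[j]].
  rewrite /revisits => /List.existsb_exists[j [/InP j_k /PeanoNat.Nat.eqb_eq ->]].
  by exists j.
move=> j_k E; apply/List.existsb_exists; exists j.
by rewrite E PeanoNat.Nat.eqb_refl; split=> //; apply/InP.
Qed.

Lemma freshE f v m j :
  fresh m f (fiter f j v) (rev [seq fiter f i v | i <- iota 0 j]) =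
  all (fun i => ~~ revisits f v i) (iota j.+1 m).
Proof.
elim: m j => [|m IHm] j //=.
have -> : fiter f j v :: rev [seq fiter f i v | i <- iota 0 j] =
          rev [seq fiter f i v | i <- iota 0 j.+1].
  by rewrite -addn1 iotaD map_cat rev_cat.
by rewrite -[fapp f _]/(fiter f j.+1 v) IHm revisitsE mem_rev.
Qed.

Lemma first_trueP P s fuel :
  match first_true P s fuel with
  | Some k => [/\ s <= k < s + fuel, P k & forall i, s <= i < k -> ~~ P i]
  | None => forall i, s <= i < s + fuel -> ~~ P i
  end.
Proof.
elim: fuel s => [|fuel IH] s /=; first by move=> i; lia.
case: (boolP (P s)) => Ps; first by split=> //; [lia | move=> i; lia].
have := IH s.+1; case: first_true => [k [k_s Pk nP]|nP].
  split=> [||i i_s] //; first lia.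
  by have [->|i_neq] := eqVneq i s; [|apply: nP; lia].
by move=> i i_s; have [->|i_neq] := eqVneq i s; [|apply: nP; lia].
Qed.

(** The search stops at the first revisit, so [k] lies below its result exactly when the first [k]
    steps are fresh. The bound [n.+1] is just the end of the search range. *)
Lemma sixlen_spec n d f v : f \in Fd n d -> v < n ->
  sixlen n f v <= n.+1 /\ forall k, fresh k f v [::] = (k < sixlen n f v).
Proof.
move=> f_in v_n; have freshV m : fresh m f v [::] = all (fun i => ~~ revisits f v i) (iota 1 m).
  exact: (freshE f v m 0).
rewrite /sixlen; have := first_trueP (revisits f v) 1 n.+1.
case: first_true => [s [s_n Ps nP]|nP].
  split=> [|k]; first by lia.
  rewrite freshV; apply/allP/idP => [all_k | k_s i]; last first.
    by rewrite mem_iota => i_k; apply: nP; lia.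
  rewrite ltnNge; apply/negP => s_k.
  have /negP[//] : ~~ revisits f v s by apply: all_k; rewrite mem_iota; lia.
(* The default value 0 never occurs: a failed search would give [n] fresh steps, that is [n + 1]
   distinct points of [n]. *)
have /(fresh_bound n d) : fresh n f v [::].
  by rewrite freshV; apply/allP => i; rewrite mem_iota => i_n; apply: nP; lia.
by rewrite /= v_n add0n ltnn => /(_ f_in isT isT).
Qed.

Lemma count_sixlen n d v k : v < n ->
  count (fun f => k < sixlen n f v) (Fd n d) * 'C(n, k) =
  size (Fd n d) * elsym (erase d n [:: v]) k.
Proof.
move=> v_n; have := count_fresh n d k v [::] isT.
rewrite /= v_n subn0 /nfollow count_predT => <- //; congr (_ * _).
by apply: eq_in_count => f f_in; have [_ ->] := sixlen_spec n d f v f_in v_n.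
Qed.

Lemma length_Fd_neq0 n d : is_degree_sequence n d -> length (Fd n d) <> 0.
Proof. by move=> /Fd_neq0; rewrite lt0n => /eqP. Qed.

Lemma sixlen_le n d f v : List.In f (Fd n d) -> (v < n)%coq_nat -> (sixlen n f v <= n.+1)%coq_nat.
Proof. by move=> /InP f_in /ltP v_n; have [/leP] := sixlen_spec n d f v f_in v_n. Qed.

(** The binomial coefficient is written as e_k(1, ..., 1), so that [mix_esym] applies both to the
    binomial law and to the degree product. *)
Lemma length_sixlen n d v k : (v < n)%coq_nat ->
  length (List.filter (fun f => PeanoNat.Nat.ltb k (sixlen n f v)) (Fd n d)) *
    elsym (List.repeat 1 n) k =
  length (Fd n d) *
    elsym (List.map (fun i => if PeanoNat.Nat.eqb i v then 0 else d i) (List.seq 0 n)) k.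
Proof.
move=> /ltP v_n; have := count_sixlen n d v k v_n.
have -> : 'C(n, k) = elsym (List.repeat 1 n) k.
  by rewrite -elsym_ones; congr elsym; elim: n {v_n} => //= n ->.
have -> : erase d n [:: v] =
    List.map (fun i => if PeanoNat.Nat.eqb i v then 0 else d i) (List.seq 0 n).
  rewrite /erase -[List.seq 0 n]/(iota 0 n); apply: eq_map => i; rewrite inE.
  by congr (if _ then _ else _); apply/eqP/idP => /PeanoNat.Nat.eqb_eq.
rewrite -size_filter => <-; congr (size _ * _); apply: eq_filter => f.
by apply/idP/idP => [/PeanoNat.Nat.ltb_lt/ltP | /ltP/PeanoNat.Nat.ltb_lt].
Qed.

End Counting.

(** * Binomial mixtures *)

Lemma elsym_gt (l : list nat) (k : nat) : (length l < k)%nat -> elsym l k = 0%nat.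
Proof.
revert k; induction l as [|a l IHl]; intros [|k] Hk; simpl in *; try lia.
change ((elsym l (S k) + a * elsym l k)%nat = 0%nat).
rewrite !IHl by lia; lia.
Qed.

(* [mix th (repeat 1 n) g] is the expectation of [g] under the binomial law
   with parameters [n] and [th]. *)
Fixpoint mix (th : R) (l : list nat) (g : nat -> R) : R :=
  match l with
  | nil => g 0%nat
  | a :: l' => (1 - th) * mix th l' g + INR a * th * mix th l' (fun k => g (S k))
  end.

(** Each entry [a] contributes either [1 - th] or [a * th], and [g] sees how often the second was
    chosen. With [g] constant 1 this is the product of the factors 1 + (a - 1) th. *)
Lemma mix_esym (th : R) (l : list nat) (g : nat -> R) :
  mix th l g = sum_f_R0
    (fun k => INR (elsym l k) * th ^ k * (1 - th) ^ (length l - k) * g k) (length l).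
Proof.
revert g; induction l as [|a l IHl]; intros g; [simpl; lra|].
cbn [mix length]; rewrite !IHl; set (n := length l).
rewrite (decomp_sum _ (S n)) by lia; cbn [pred].
rewrite (sum_eq (fun i => INR (elsym (a :: l) (S i)) * th ^ S i *
                          (1 - th) ^ (S n - S i) * g (S i))
  (fun i => INR (elsym l (S i)) * th ^ S i * (1 - th) ^ (n - i) * g (S i) +
    INR (elsym l i) * th ^ i * (1 - th) ^ (n - i) * g (S i) * (INR a * th))).
2:{ intros i _.
    change (INR (elsym l (S i) + a * elsym l i) * th ^ S i * (1 - th) ^ (S n - S i) * g (S i) =
            INR (elsym l (S i)) * th ^ S i * (1 - th) ^ (n - i) * g (S i) +
    INR (elsym l i) * th ^ i * (1 - th) ^ (n - i) * g (S i) * (INR a * th)).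
    rewrite plus_INR, mult_INR, Nat.sub_succ; simpl; ring. }
rewrite plus_sum, <- (scal_sum _ _ (INR a * th)), <- Rplus_assoc.
rewrite (Rmult_comm (INR a * th)); f_equal.
assert (Hsplit := decomp_sum
  (fun k => INR (elsym l k) * th ^ k * (1 - th) ^ (S n - k) * g k) (S n) ltac:(lia)).
cbn [pred] in Hsplit.
rewrite (elsym0 (a :: l)); rewrite (elsym0 l) in Hsplit.
rewrite (sum_eq (fun i => INR (elsym l (S i)) * th ^ S i * (1 - th) ^ (n - i) * g (S i))
  (fun i => INR (elsym l (S i)) * th ^ S i * (1 - th) ^ (S n - S i) * g (S i)))
  by (intros i _; now rewrite Nat.sub_succ).
rewrite <- Hsplit, tech5, (elsym_gt l (S n)) by (unfold n; lia).
rewrite scal_sum; simpl INR; ring_simplify.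
apply sum_eq; intros i Hi; replace (S n - i)%nat with (S (n - i)) by lia; simpl; ring.
Qed.

Lemma mix_ext (th : R) (l : list nat) (f g : nat -> R) :
  (forall k, f k = g k) -> mix th l f = mix th l g.
Proof.
revert f g; induction l as [|a l IHl]; intros f g H; simpl; auto.
now rewrite (IHl f g), (IHl (fun k => f (S k)) (fun k => g (S k))); auto.
Qed.

Lemma mix_lin (th : R) (l : list nat) (f g : nat -> R) (x y : R) :
  mix th l (fun k => x * f k + y * g k) = x * mix th l f + y * mix th l g.
Proof.
revert f g; induction l as [|a l IHl]; intros f g; simpl; [ring|].
rewrite (IHl f g), (IHl (fun k => f (S k)) (fun k => g (S k))); ring.
Qed.

Lemma mix_le (th : R) (l : list nat) (f g : nat -> R) : 0 <= th <= 1 ->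
  (forall k, f k <= g k) -> mix th l f <= mix th l g.
Proof.
intros Hth; revert f g; induction l as [|a l IHl]; intros f g H; simpl; auto.
apply Rplus_le_compat; apply Rmult_le_compat_l; try lra; auto.
apply Rmult_le_pos; [apply pos_INR | lra].
Qed.

Lemma mix_binom_1 (th : R) (n : nat) : mix th (repeat 1%nat n) (fun _ => 1) = 1.
Proof. induction n as [|n IHn]; simpl; [|rewrite IHn]; ring. Qed.

Lemma mix_binom_mean (th : R) (n : nat) : mix th (repeat 1%nat n) INR = INR n * th.
Proof.
induction n as [|n IHn]; [simpl; ring|].
cbn [repeat mix].
rewrite (mix_ext _ _ (fun k => INR (S k)) (fun k => 1 * INR k + 1 * (fun _ => 1) k))
  by (intros k; rewrite S_INR; ring).
rewrite mix_lin, mix_binom_1, IHn, (S_INR n); change (INR 1) with 1; ring.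
Qed.

(** Variance plus squared bias. The centre [c] is arbitrary because a success in the induction
    shifts it by one. *)
Lemma mix_binom_square (th c : R) (n : nat) :
  mix th (repeat 1%nat n) (fun k => (INR k - c) ^ 2) =
  INR n * th * (1 - th) + (INR n * th - c) ^ 2.
Proof.
revert c; induction n as [|n IHn]; intros c; [simpl; ring|].
cbn [repeat mix].
rewrite (mix_ext _ _ (fun k => (INR (S k) - c) ^ 2) (fun k => (INR k - (c - 1)) ^ 2))
  by (intros k; rewrite S_INR; ring).
rewrite !IHn, (S_INR n); change (INR 1) with 1; ring.
Qed.

(** * Comparing a decreasing sequence with its binomial averages *)

Section Sandwich.
Variables (n : nat) (l : list nat) (q : nat -> R).
Hypothesis length_l : length l = n.
Hypothesis q_esym : forall k, (k <= n)%nat ->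
  q k * INR (elsym (repeat 1%nat n) k) = INR (elsym l k).
Hypothesis q_decr : forall i k, (i <= k)%nat -> q k <= q i.
Hypothesis q_01 : forall k, 0 <= q k <= 1.

(** The C(n,k) in the binomial weight cancels the denominator of [q k], leaving the generating
    product of [l]. *)
Lemma mix_binom_q (th : R) : mix th (repeat 1%nat n) q = mix th l (fun _ => 1).
Proof.
rewrite !mix_esym, repeat_length, length_l; apply sum_eq; intros k Hk.
rewrite <- q_esym by assumption; ring.
Qed.

Lemma q_upper (th : R) (k : nat) : 0 <= th <= 1 -> INR n * th < INR k ->
  q k <= mix th l (fun _ => 1) + INR n * th / (INR k - INR n * th) ^ 2.
Proof.
intros Hth Hk.
set (c := / (INR k - INR n * th) ^ 2).
assert (Hc : 0 < c) by (apply Rinv_0_lt_compat, pow_lt; lra).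
(* Chebyshev in pointwise form: monotonicity settles [i <= k], and for larger [i] the quadratic term
   is at least 1. The padding by [0 * 1] gives both sides the shape expected by [mix_lin]. *)
assert (Hle : forall i, q k * 1 + 0 * 1 <= 1 * q i + c * (INR i - INR n * th) ^ 2).
{ intros i; destruct (Nat.le_gt_cases i k) as [Hik|Hik].
  - assert (q k <= q i) by (now apply q_decr).
    assert (0 <= c * (INR i - INR n * th) ^ 2) by (apply Rmult_le_pos; [lra | apply pow2_ge_0]).
    lra.
  - apply lt_INR in Hik.
    assert (1 <= c * (INR i - INR n * th) ^ 2).
    { replace 1 with (c * (INR k - INR n * th) ^ 2).
      - apply Rmult_le_compat_l; [lra | apply pow_incr; lra].
      - unfold c; apply Rinv_l, pow_nonzero; lra. }
    destruct (q_01 k), (q_01 i); lra. }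
apply (mix_le th (repeat 1%nat n)) in Hle; [|assumption].
rewrite !mix_lin, mix_binom_1, mix_binom_square, mix_binom_q in Hle.
assert (0 <= INR n * th) by (apply Rmult_le_pos; [apply pos_INR | lra]).
assert (0 <= c * (INR n * th) * th) by (apply Rmult_le_pos; [apply Rmult_le_pos|]; lra).
unfold Rdiv; fold c; lra.
Qed.

Lemma q_lower (th : R) (k : nat) : 0 <= th <= 1 -> INR k < INR n * th ->
  mix th l (fun _ => 1) <= q k + INR n * th / (INR n * th - INR k) ^ 2.
Proof.
intros Hth Hk.
set (c := / (INR n * th - INR k) ^ 2).
assert (Hc : 0 < c) by (apply Rinv_0_lt_compat, pow_lt; lra).
(* The mirror image: monotonicity settles [k <= i], and the quadratic term pays for smaller [i]. *)
assert (Hle : forall i, 1 * q i + 0 * 1 <= 1 * (q k * 1 + 0 * 1) + c * (INR i - INR n * th) ^ 2).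
{ intros i; destruct (Nat.le_gt_cases k i) as [Hik|Hik].
  - assert (q i <= q k) by (now apply q_decr).
    assert (0 <= c * (INR i - INR n * th) ^ 2) by (apply Rmult_le_pos; [lra | apply pow2_ge_0]).
    lra.
  - apply lt_INR in Hik.
    assert (1 <= c * (INR i - INR n * th) ^ 2).
    { replace 1 with (c * (INR n * th - INR k) ^ 2).
      - apply Rmult_le_compat_l; [lra|].
        replace ((INR i - INR n * th) ^ 2) with ((INR n * th - INR i) ^ 2) by ring.
        apply pow_incr; lra.
      - unfold c; apply Rinv_l, pow_nonzero; lra. }
    destruct (q_01 k), (q_01 i); lra. }
apply (mix_le th (repeat 1%nat n)) in Hle; [|assumption].
rewrite !mix_lin, mix_binom_1, mix_binom_square, mix_binom_q in Hle.
assert (0 <= INR n * th) by (apply Rmult_le_pos; [apply pos_INR | lra]).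
assert (0 <= c * (INR n * th) * th) by (apply Rmult_le_pos; [apply Rmult_le_pos|]; lra).
unfold Rdiv; fold c; lra.
Qed.

(* Markov: a binomial variable of mean [k / 2] is at most [k] with probability at least 1/2. *)
Lemma q_tail (k : nat) : (0 < k <= n)%nat ->
  q k <= 2 * mix (INR k / (2 * INR n)) l (fun _ => 1).
Proof.
intros [Hk Hkn]; set (th := INR k / (2 * INR n)).
apply lt_INR in Hk; simpl in Hk; apply le_INR in Hkn.
assert (Hth : 0 <= th <= 1).
{ unfold th; split; [apply Rlt_le, Rdiv_lt_0_compat; lra|].
  apply Rmult_le_reg_r with (2 * INR n); [lra|]; field_simplify; lra. }
(* The affine minorant [q k * (1 - i / k)] of [q i] has binomial mean [q k / 2], because the mean of
   [i] is [k / 2]. *)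
assert (H : forall i, q k * 1 + (- q k / INR k) * INR i <= 1 * q i + 0 * 1).
{ intros i.
  replace (q k * 1 + - q k / INR k * INR i) with (q k * (1 - INR i / INR k)) by (field; lra).
  destruct (q_01 k) as [Hq _].
  assert (0 <= INR i / INR k) by (apply Rdiv_le_0_compat; [apply pos_INR | lra]).
  destruct (Nat.le_gt_cases i k) as [Hik|Hik].
  - assert (q k <= q i) by (now apply q_decr); nra.
  - apply lt_INR in Hik.
    assert (1 <= INR i / INR k)
      by (apply Rmult_le_reg_r with (INR k); [lra|]; field_simplify; lra).
    destruct (q_01 i); nra. }
apply (mix_le th (repeat 1%nat n)) in H; [|assumption].
rewrite !mix_lin, mix_binom_1, mix_binom_mean, mix_binom_q in H.
replace (- q k / INR k * (INR n * th)) with (- q k / 2) in H by (unfold th; field; lra).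
lra.
Qed.

End Sandwich.

(** * Second order bounds for the generating product *)

Lemma exp_le_exp (x y : R) : x <= y -> exp x <= exp y.
Proof. intros [H| ->]; [apply Rlt_le, exp_increasing, H | apply Rle_refl]. Qed.

(** The difference of the logarithms, [f], has derivative [t * (t - c) / ((1 + c) * (1 + t))]. By
    the mean value theorem [f u] is [t * u * (t - c)] times a positive factor, with [t] between 0
    and [u]; as [t * u >= 0], the sign of [t - c] decides. *)
Lemma exp_quadratic (c u : R) : -1 < c -> -1 < u ->
  (0 <= c -> u <= c -> 1 + u <= exp (u - u ^ 2 / (2 * (1 + c)))) /\
  (c <= 0 -> c <= u -> exp (u - u ^ 2 / (2 * (1 + c))) <= 1 + u).
Proof.
intros Hc Hu.
set (f := fun t => ln (1 + t) - t + t ^ 2 / (2 * (1 + c))).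
set (f' := fun t => t * (t - c) / ((1 + c) * (1 + t))).
assert (Hder : forall t, Rmin 0 u <= t <= Rmax 0 u -> is_derive f t (f' t)).
{ intros t [Ht _]; assert (-1 < t) by (unfold Rmin in Ht; destruct (Rle_dec 0 u); lra).
  unfold f, f'; auto_derive; [lra | field; lra]. }
destruct (MVT_gen f 0 u f') as (t & Ht & Hf).
{ intros t [Ht1 Ht2]; apply Hder; lra. }
{ intros t Ht; apply continuity_pt_filterlim, (ex_derive_continuous f).
  exists (f' t); now apply Hder. }
assert (Hf0 : f 0 = 0) by (unfold f; rewrite Rplus_0_r, ln_1; field; lra).
rewrite Hf0 in Hf.
assert (Ht1 : -1 < t) by (destruct Ht as [Ht _]; unfold Rmin in Ht; destruct (Rle_dec 0 u); lra).
assert (Hsign : f u = (t * u) * (t - c) * / ((1 + c) * (1 + t)))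
  by (unfold f', Rdiv in Hf; lra).
assert (Hpos : 0 < / ((1 + c) * (1 + t))) by (apply Rinv_0_lt_compat, Rmult_lt_0_compat; lra).
assert (Htu : 0 <= t * u).
{ unfold Rmin, Rmax in Ht; destruct (Rle_dec 0 u); nra. }
assert (Hexp : 1 + u = exp (f u + (u - u ^ 2 / (2 * (1 + c))))).
{ unfold f.
  replace (ln (1 + u) - u + u ^ 2 / (2 * (1 + c)) + (u - u ^ 2 / (2 * (1 + c))))
    with (ln (1 + u)) by ring.
  rewrite exp_ln; lra. }
split; intros Hc0 Huc.
- rewrite Hexp; apply exp_le_exp.
  assert (t * u * (t - c) <= 0).
  { unfold Rmin, Rmax in Ht; destruct (Rle_dec 0 u); nra. }
  assert (f u <= 0) by (rewrite Hsign; nra); lra.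
- rewrite Hexp; apply exp_le_exp.
  assert (0 <= t * u * (t - c)).
  { unfold Rmin, Rmax in Ht; destruct (Rle_dec 0 u); nra. }
  assert (0 <= f u) by (rewrite Hsign; nra); lra.
Qed.

Definition dev1 (l : list nat) : R := rsum (map (fun a => INR a - 1) l).
Definition dev2 (l : list nat) : R := rsum (map (fun a => (INR a - 1) ^ 2) l).

(** Each factor is [1 + u] with [u = (a - 1) * th <= e], so [exp_quadratic] applies with [c = e];
    the exponents add up to the power sums [dev1] and [dev2]. *)
Lemma mix_upper (th e : R) (l : list nat) : 0 <= th < 1 -> 0 <= e ->
  (forall a, In a l -> INR a * th <= e) ->
  mix th l (fun _ => 1) <= exp (th * dev1 l - th ^ 2 * dev2 l / (2 * (1 + e))).
Proof.
intros Hth He; induction l as [|a l IHl]; intros Hl.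
- change (1 <= exp (th * 0 - th ^ 2 * 0 / (2 * (1 + e)))).
  replace (_ - _) with 0 by (field; lra); rewrite exp_0; lra.
- cbn [mix]; unfold dev1, dev2; cbn [map rsum fold_right].
  fold (rsum (map (fun a => INR a - 1) l)) (rsum (map (fun a => (INR a - 1) ^ 2) l)).
  fold (dev1 l) (dev2 l).
  set (u := (INR a - 1) * th).
  replace (th * (INR a - 1 + dev1 l) - th ^ 2 * ((INR a - 1) ^ 2 + dev2 l) / (2 * (1 + e)))
    with ((u - u ^ 2 / (2 * (1 + e))) + (th * dev1 l - th ^ 2 * dev2 l / (2 * (1 + e))))
    by (unfold u; field; lra).
  rewrite exp_plus.
  replace ((1 - th) * _ + _) with ((1 + u) * mix th l (fun _ => 1)) by (unfold u; ring).
  assert (Ha := pos_INR a); assert (Hae := Hl a (or_introl eq_refl)).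
  assert (Hath : 0 <= INR a * th) by (apply Rmult_le_pos; lra).
  assert (-1 < u) by (unfold u; lra).
  apply Rmult_le_compat; [lra | | | apply IHl; intros; apply Hl; now right].
  + rewrite <- (Rmult_0_r (mix th l (fun _ => 0))).
    apply Rle_trans with (mix th l (fun _ => 0 * 0 + 0 * 0)).
    * rewrite mix_lin; lra.
    * apply mix_le; [lra | intros; lra].
  + apply exp_quadratic; unfold u in *; try lra.
Qed.

(** Entries are at least 0, so [u >= - th] and [exp_quadratic] applies with [c = - th]. *)
Lemma mix_lower (th : R) (l : list nat) : 0 <= th < 1 ->
  exp (th * dev1 l - th ^ 2 * dev2 l / (2 * (1 - th))) <= mix th l (fun _ => 1).
Proof.
intros Hth; induction l as [|a l IHl].
- change (exp (th * 0 - th ^ 2 * 0 / (2 * (1 - th))) <= 1).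
  replace (th * 0 - _) with 0 by (field; lra); rewrite exp_0; lra.
- cbn [mix]; unfold dev1, dev2; cbn [map rsum fold_right].
  fold (rsum (map (fun a => INR a - 1) l)) (rsum (map (fun a => (INR a - 1) ^ 2) l)).
  fold (dev1 l) (dev2 l).
  set (u := (INR a - 1) * th).
  replace (th * (INR a - 1 + dev1 l) - th ^ 2 * ((INR a - 1) ^ 2 + dev2 l) / (2 * (1 - th)))
    with ((u - u ^ 2 / (2 * (1 + - th))) + (th * dev1 l - th ^ 2 * dev2 l / (2 * (1 - th))))
    by (unfold u; field; lra).
  rewrite exp_plus.
  replace ((1 - th) * _ + _) with ((1 + u) * mix th l (fun _ => 1)) by (unfold u; ring).
  assert (Ha := pos_INR a).
  assert (Hath : 0 <= INR a * th) by (apply Rmult_le_pos; lra).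
  assert (-1 < u) by (unfold u; lra).
  apply Rmult_le_compat; [apply Rlt_le, exp_pos | apply Rlt_le, exp_pos | | exact IHl].
  apply exp_quadratic; unfold u in *; nra.
Qed.

(** * The survival function of the six-length *)

Fixpoint psum (f : nat -> R) (n : nat) : R :=
  match n with
  | O => 0
  | S n' => psum f n' + f n'
  end.

Lemma psum_ext (f g : nat -> R) (n : nat) :
  (forall k, (k < n)%nat -> f k = g k) -> psum f n = psum g n.
Proof.
induction n as [|n IHn]; intros H; simpl; [reflexivity|].
rewrite IHn, H by auto; reflexivity.
Qed.

Lemma psum_le (f g : nat -> R) (n : nat) :
  (forall k, (k < n)%nat -> f k <= g k) -> psum f n <= psum g n.
Proof.
induction n as [|n IHn]; intros H; simpl; [apply Rle_refl|].
apply Rplus_le_compat; auto.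
Qed.

Lemma psum_telescope (g : nat -> R) (n : nat) :
  psum (fun k => g (S k) - g k) n = g n - g 0%nat.
Proof. induction n as [|n IHn]; simpl; [|rewrite IHn]; ring. Qed.

Lemma psum_split (f : nat -> R) (m n : nat) :
  psum f (m + n) = psum f m + psum (fun k => f (m + k)%nat) n.
Proof.
induction n as [|n IHn]; simpl; [rewrite Nat.add_0_r; ring|].
rewrite Nat.add_succ_r; simpl; rewrite IHn; ring.
Qed.

Definition survival (n : nat) (d : nat -> nat) (v k : nat) : R :=
  INR (length (filter (fun f => Nat.ltb k (sixlen n f v)) (Fd n d))) / INR (length (Fd n d)).

Definition erased (n : nat) (d : nat -> nat) (v : nat) : list nat :=
  map (fun i => if Nat.eqb i v then 0%nat else d i) (seq 0 n).

Lemma length_filter_le {T : Type} (P Q : T -> bool) (l : list T) :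
  (forall x, In x l -> P x = true -> Q x = true) ->
  (length (filter P l) <= length (filter Q l))%nat.
Proof.
induction l as [|a l IHl]; intros H; simpl; [lia|].
assert (IH := IHl (fun x Hx => H x (or_intror Hx))).
assert (Ha := H a (or_introl eq_refl)).
destruct (P a); [rewrite Ha by reflexivity; simpl; lia|].
destruct (Q a); simpl; lia.
Qed.

Section Survival.
Variables (n : nat) (d : nat -> nat) (v : nat).
Hypothesis Hd : is_degree_sequence n d.
Hypothesis Hv : (v < n)%nat.

Lemma Fd_INR_pos : 0 < INR (length (Fd n d)).
Proof. apply lt_0_INR; assert (H := Counting.length_Fd_neq0 n d Hd); lia. Qed.

Lemma survival_esym (k : nat) :
  survival n d v k * INR (elsym (repeat 1%nat n) k) = INR (elsym (erased n d v) k).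
Proof.
assert (Hpos := Fd_INR_pos).
assert (H := Counting.length_sixlen n d v k Hv); apply (f_equal INR) in H.
change (INR (length (filter (fun f => Nat.ltb k (sixlen n f v)) (Fd n d)) *
    elsym (repeat 1%nat n) k) = INR (length (Fd n d) * elsym (erased n d v) k)) in H.
rewrite !mult_INR in H; unfold survival.
apply Rmult_eq_reg_l with (INR (length (Fd n d))); [|lra].
rewrite <- H; field; lra.
Qed.

Lemma survival_decr (i k : nat) : (i <= k)%nat -> survival n d v k <= survival n d v i.
Proof.
intros Hik; apply Rmult_le_compat_r; [apply Rlt_le, Rinv_0_lt_compat, Fd_INR_pos|].
apply le_INR, length_filter_le; intros f _ Hf.
apply Nat.ltb_lt; apply Nat.ltb_lt in Hf; lia.
Qed.

Lemma survival_01 (k : nat) : 0 <= survival n d v k <= 1.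
Proof.
assert (Hpos := Fd_INR_pos); unfold survival; split.
- apply Rdiv_le_0_compat; [apply pos_INR | assumption].
- apply Rmult_le_reg_r with (INR (length (Fd n d))); [assumption|].
  field_simplify; [|lra]; apply le_INR, filter_length_le.
Qed.

Lemma survival_big (k : nat) : (n < k)%nat -> survival n d v k = 0.
Proof.
intros Hk; unfold survival.
replace (filter _ _) with (@nil (list nat)); [simpl; unfold Rdiv; ring|].
symmetry; apply length_zero_iff_nil.
apply Nat.le_0_r; rewrite <- (proj2 (length_zero_iff_nil (filter (fun _ => false) (Fd n d)))).
- apply length_filter_le; intros f Hf Hfk; apply Nat.ltb_lt in Hfk.
  assert (H := Counting.sixlen_le n d f v Hf Hv); simpl in *; lia.
- now induction (Fd n d).
Qed.

(** Summation by parts: [g s] is [g 0] plus the increments of [g] at all [k < s]. Truncating at [N]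
    loses nothing, since the six-length is at most [n + 1 <= N]. *)
Lemma expect_survival (g : nat -> R) (N : nat) : (n < N)%nat ->
  expect_s n d v g = g 0%nat + psum (fun k => (g (S k) - g k) * survival n d v k) N.
Proof.
intros HN; assert (Hpos := Fd_INR_pos).
assert (Hsum : forall l, (forall f, In f l -> In f (Fd n d)) ->
  rsum (map (fun f => g (sixlen n f v)) l) = g 0%nat * INR (length l) +
  psum (fun k => (g (S k) - g k) *
          INR (length (filter (fun f => Nat.ltb k (sixlen n f v)) l))) N).
{ induction l as [|f l IHl]; intros Hl.
  - simpl; rewrite (psum_ext _ (fun k => 0 - 0)) by (intros; simpl; ring).
    rewrite (psum_telescope (fun _ => 0)); ring.
  - cbn [map rsum fold_right length]; fold (rsum (map (fun f => g (sixlen n f v)) l)).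
    rewrite IHl by (intros; apply Hl; now right).
    rewrite S_INR.
    assert (Hf := Counting.sixlen_le n d f v (Hl f (or_introl eq_refl)) Hv).
    set (s := sixlen n f v) in *.
    assert (Hs : forall M, (s <= M)%nat ->
      psum (fun k => (g (S k) - g k) * (if Nat.ltb k s then 1 else 0)) M = g s - g 0%nat).
    { intros M HM; replace M with (s + (M - s))%nat by lia; rewrite psum_split.
      rewrite (psum_ext _ (fun k => g (S k) - g k) s).
      - rewrite psum_telescope, (psum_ext _ (fun k => 0 - 0)), (psum_telescope (fun _ => 0)).
        + ring.
        + intros k _; replace (s + k <? s)%nat with false by (symmetry; apply Nat.ltb_ge; lia).
          ring.
      - intros k Hk; apply Nat.ltb_lt in Hk; rewrite Hk; ring. }
    assert (Hadd : forall u w M, psum u M + psum w M = psum (fun k => u k + w k) M).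
    { intros u w M; induction M as [|M IHM]; simpl; [|rewrite <- IHM]; ring. }
    transitivity (g 0%nat * (INR (length l) + 1) +
      (psum (fun k => (g (S k) - g k) * (if Nat.ltb k s then 1 else 0)) N +
       psum (fun k => (g (S k) - g k) *
          INR (length (filter (fun f => Nat.ltb k (sixlen n f v)) l))) N)).
    { rewrite Hs by (simpl in Hf; lia); ring. }
    rewrite Hadd; f_equal; apply psum_ext; intros k _; cbn [filter]; fold s.
    destruct (k <? s)%nat; cbn [length]; rewrite ?S_INR; ring. }
unfold expect_s; rewrite Hsum by auto; unfold survival.
assert (Hscal : forall u M, psum u M / INR (length (Fd n d)) =
                            psum (fun k => u k / INR (length (Fd n d))) M).
{ intros u M; induction M as [|M IHM]; simpl; [|rewrite <- IHM]; unfold Rdiv; ring. }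
rewrite Rdiv_plus_distr, Hscal; f_equal; [field; lra|].
apply psum_ext; intros k _; unfold Rdiv; ring.
Qed.

Lemma rsum_erased (h : nat -> R) :
  rsum (map h (erased n d v)) = rsum (map (fun i => h (d i)) (seq 0 n)) - h (d v) + h 0%nat.
Proof.
unfold erased; rewrite map_map.
(* The membership test lets the induction run over lists that do not yet contain [v]. *)
assert (H : forall l, NoDup l ->
  rsum (map (fun i => h (if i =? v then 0%nat else d i)) l) =
  rsum (map (fun i => h (d i)) l) + (if in_dec Nat.eq_dec v l then h 0%nat - h (d v) else 0)).
{ induction l as [|a l IHl]; intros Hnd; [simpl; ring|].
  inversion Hnd as [|? ? Ha Hl]; subst.
  cbn [map]; unfold rsum; cbn [fold_right]; fold (rsum (map (fun i => h (d i)) l)).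
  fold (rsum (map (fun i => h (if i =? v then 0%nat else d i)) l)); rewrite IHl by assumption.
  destruct (Nat.eqb_spec a v) as [->|Hav].
  - destruct (in_dec Nat.eq_dec v l) as [Hin|_]; [contradiction|].
    destruct (in_dec Nat.eq_dec v (v :: l)) as [_|Hn]; [ring|].
    exfalso; apply Hn; now left.
  - destruct (in_dec Nat.eq_dec v l) as [Hin|Hin];
      destruct (in_dec Nat.eq_dec v (a :: l)) as [Hin'|Hin']; try ring;
      exfalso; simpl in Hin'; intuition. }
rewrite H by apply seq_NoDup.
destruct (in_dec Nat.eq_dec v (seq 0 n)) as [_|Hn]; [ring|].
exfalso; apply Hn, in_seq; lia.
Qed.

Lemma sum_INR_d : rsum (map (fun i => INR (d i)) (seq 0 n)) = INR n.
Proof.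
rewrite <- Hd at 2; induction (seq 0 n) as [|a l IHl]; [reflexivity|].
cbn [map]; unfold rsum, nsum; cbn [fold_right]; rewrite plus_INR; f_equal; exact IHl.
Qed.

(** The degrees sum to [n], so the deviations [d i - 1] cancel before erasure; erasing replaces
    [d v - 1] by [- 1]. *)
Lemma dev1_erased : dev1 (erased n d v) = - INR (d v).
Proof.
unfold dev1; rewrite (rsum_erased (fun a => INR a - 1)); simpl INR.
assert (H : forall l, rsum (map (fun i => INR (d i) - 1) l) =
                      rsum (map (fun i => INR (d i)) l) - INR (length l)).
{ induction l as [|a l IHl]; [simpl; ring|].
  unfold rsum in *; cbn [map fold_right length]; rewrite IHl, S_INR; ring. }
rewrite H, length_seq, sum_INR_d; ring.
Qed.

(** Expanding the square gives m_2 - 2n + n, which is n sigma^2. *)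
Lemma sum_square_dev :
  rsum (map (fun i => (INR (d i) - 1) ^ 2) (seq 0 n)) = INR n * sigma2 n d.
Proof.
assert (H : forall l, rsum (map (fun i => (INR (d i) - 1) ^ 2) l) =
   INR (nsum (map (fun j => d j * d j)%nat l)) - 2 * rsum (map (fun i => INR (d i)) l)
   + INR (length l)).
{ induction l as [|a l IHl]; [simpl; ring|].
  unfold rsum, nsum in *; cbn [map fold_right length].
  rewrite IHl, S_INR, plus_INR, mult_INR; ring. }
rewrite H, length_seq, sum_INR_d; fold (m2 n d).
assert (0 < INR n) by (apply lt_0_INR; lia).
unfold sigma2; field; lra.
Qed.

Lemma sigma2_ge_0 : 0 <= sigma2 n d.
Proof.
assert (Hn : 0 < INR n) by (apply lt_0_INR; lia).
apply Rmult_le_reg_l with (INR n); [exact Hn|].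
rewrite Rmult_0_r, <- sum_square_dev; unfold rsum.
induction (seq 0 n) as [|i l IHl]; cbn [map fold_right]; [lra|].
assert (H := pow2_ge_0 (INR (d i) - 1)); lra.
Qed.

Lemma dev2_erased :
  dev2 (erased n d v) = INR n * sigma2 n d + 2 * INR (d v) - INR (d v) ^ 2.
Proof.
unfold dev2; rewrite (rsum_erased (fun a => (INR a - 1) ^ 2)), sum_square_dev.
simpl (INR 0); ring.
Qed.

Lemma erased_le (a : nat) : In a (erased n d v) -> (a <= maxdeg n d)%nat.
Proof.
intros Ha; apply in_map_iff in Ha; destruct Ha as (i & <- & Hi).
destruct (i =? v)%nat; [lia|].
assert (H := proj1 (list_max_le (map d (seq 0 n)) (maxdeg n d)) (le_n _)).
rewrite Forall_forall in H; apply H, in_map, Hi.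
Qed.

Lemma d_v_le : (d v <= maxdeg n d)%nat.
Proof.
assert (H := proj1 (list_max_le (map d (seq 0 n)) (maxdeg n d)) (le_n _)).
rewrite Forall_forall in H; apply H, in_map, in_seq; lia.
Qed.

End Survival.

(** * Quantitative bounds on the survival function *)

Section Bounds.
Variables (n : nat) (d : nat -> nat) (v : nat).
Hypothesis Hd : is_degree_sequence n d.
Hypothesis Hv : (v < n)%nat.
Hypothesis Hs : 0 < sigma2 n d.

(** [a] is the scale of the six-length and [r ^ 2] the total squared deviation of the degrees. Since
    [a * r = n], the parameter [th = x / r] has binomial mean [x * a]. *)
Let a := sqrt (INR n / sigma2 n d).
Let r := sqrt (INR n * sigma2 n d).
Let D := INR (maxdeg n d).

Lemma INR_n_pos : 0 < INR n.
Proof. apply lt_0_INR; lia. Qed.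

Lemma scale_pos : 0 < a.
Proof. apply sqrt_lt_R0, Rdiv_lt_0_compat; [apply INR_n_pos | assumption]. Qed.

Lemma root_pos : 0 < r.
Proof. apply sqrt_lt_R0, Rmult_lt_0_compat; [apply INR_n_pos | assumption]. Qed.

Lemma scale_root : a * r = INR n.
Proof.
assert (Hn := INR_n_pos); unfold a, r.
rewrite <- sqrt_mult.
- replace (_ * _) with (INR n ^ 2) by (field; lra).
  rewrite sqrt_pow2; lra.
- apply Rlt_le, Rdiv_lt_0_compat; lra.
- apply Rmult_le_pos; lra.
Qed.

Lemma root_square : r ^ 2 = INR n * sigma2 n d.
Proof.
assert (Hn := INR_n_pos).
unfold r; rewrite pow2_sqrt; [reflexivity | apply Rmult_le_pos; lra].
Qed.

(** The correction [2 * d v - d v ^ 2] equals [1 - (d v - 1) ^ 2], hence is at most 1, and it is at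
    least [- D ^ 2]. *)
Lemma dev2_bounds : r ^ 2 - D ^ 2 <= dev2 (erased n d v) <= r ^ 2 + 1.
Proof.
rewrite (dev2_erased n d v Hd Hv), root_square.
assert (H0 := pos_INR (d v)); assert (H1 := le_INR _ _ (d_v_le n d v Hv)); fold D in H1.
assert (H2 := pow2_ge_0 (INR (d v) - 1)); assert (H3 := pow_incr _ _ 2 (conj H0 H1)).
split; lra.
Qed.

Lemma mix_erased_upper (th : R) : 0 <= th < 1 ->
  mix th (erased n d v) (fun _ => 1) <=
  exp (- (th ^ 2 * (r ^ 2 - D ^ 2) / (2 * (1 + th * D)))).
Proof.
intros Hth.
assert (HD : 0 <= D) by apply pos_INR.
assert (HthD : 0 <= th * D) by (apply Rmult_le_pos; lra).
eapply Rle_trans; [apply (mix_upper th (th * D)); try assumption|].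
- intros i Hi; apply (erased_le n d v Hv), le_INR in Hi; fold D in Hi; nra.
- apply exp_le_exp; rewrite (dev1_erased n d v Hd Hv).
  assert (0 <= th * INR (d v)) by (apply Rmult_le_pos; [lra | apply pos_INR]).
  assert (H' : th ^ 2 * (r ^ 2 - D ^ 2) / (2 * (1 + th * D)) <=
              th ^ 2 * dev2 (erased n d v) / (2 * (1 + th * D))).
  { apply Rmult_le_compat_r; [apply Rlt_le, Rinv_0_lt_compat; lra|].
    apply Rmult_le_compat_l; [apply pow2_ge_0 | apply dev2_bounds]. }
  lra.
Qed.

Lemma mix_erased_lower (th : R) : 0 <= th < 1 ->
  exp (- (th * D) - th ^ 2 * (r ^ 2 + 1) / (2 * (1 - th))) <=
  mix th (erased n d v) (fun _ => 1).
Proof.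
intros Hth; eapply Rle_trans; [|apply mix_lower; assumption].
apply exp_le_exp; rewrite (dev1_erased n d v Hd Hv).
assert (H1 := le_INR _ _ (d_v_le n d v Hv)); fold D in H1.
assert (th * INR (d v) <= th * D) by (apply Rmult_le_compat_l; lra).
assert (H' : th ^ 2 * dev2 (erased n d v) / (2 * (1 - th)) <=
            th ^ 2 * (r ^ 2 + 1) / (2 * (1 - th))).
{ apply Rmult_le_compat_r; [apply Rlt_le, Rinv_0_lt_compat; lra|].
  apply Rmult_le_compat_l; [apply pow2_ge_0 | apply dev2_bounds]. }
lra.
Qed.

Lemma length_erased : length (erased n d v) = n.
Proof. unfold erased; now rewrite length_map, length_seq. Qed.

(** [q_tail] sets [th * r = k / (2 * a)]; a quarter of this is the rate [k / (8 * a)]. The prefactor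
    also covers [k = 0], and beyond [n] the survival function vanishes. *)
Lemma survival_tail (k : nat) : 2 * D ^ 2 <= r ^ 2 ->
  survival n d v k <= 2 * exp (1 / 4) * exp (- (INR k / (8 * a))).
Proof.
intros HDr.
assert (Ha := scale_pos); assert (Hr := root_pos); assert (Hn := INR_n_pos).
assert (HD : 0 <= D) by apply pos_INR.
destruct (Nat.eq_dec k 0) as [-> | Hk0].
{ simpl INR; replace (- (0 / (8 * a))) with 0 by (field; lra).
  rewrite exp_0; assert (H := exp_ineq1_le (1 / 4)).
  destruct (survival_01 n d v Hd Hv 0); lra. }
destruct (Nat.le_gt_cases k n) as [Hkn|Hkn].
2:{ rewrite survival_big by assumption.
    apply Rmult_le_pos; [|apply Rlt_le, exp_pos].
    assert (H := exp_pos (1 / 4)); lra. }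
eapply Rle_trans.
{ apply (q_tail n (erased n d v) (survival n d v)); try lia.
  - apply length_erased.
  - intros; now apply survival_esym.
  - intros; now apply survival_decr.
  - intros; now apply survival_01. }
rewrite Rmult_assoc; apply Rmult_le_compat_l; [lra|]; rewrite <- exp_plus.
set (th := INR k / (2 * INR n)).
assert (Hk : 0 < INR k) by (apply lt_0_INR; lia).
assert (Hth : 0 < th <= / 2).
{ apply le_INR in Hkn; unfold th; split; [apply Rdiv_lt_0_compat; lra|].
  apply Rmult_le_reg_r with (2 * INR n); [lra|]; field_simplify; lra. }
eapply Rle_trans; [apply mix_erased_upper; lra|].
apply exp_le_exp.
replace (INR k / (8 * a)) with (th * r / 4).
2:{ unfold th; rewrite <- scale_root; field; lra. }
assert (Hy : 0 < th * r) by (apply Rmult_lt_0_compat; lra).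
assert (HDr' : D <= r) by nra.
assert (HyD : th * D <= th * r) by (apply Rmult_le_compat_l; lra).
assert (HthD : 0 <= th * D) by (apply Rmult_le_pos; lra).
assert (Hnum : (th * r) ^ 2 / 2 <= th ^ 2 * (r ^ 2 - D ^ 2)).
{ replace ((th * r) ^ 2 / 2) with (th ^ 2 * (r ^ 2 / 2)) by field.
  apply Rmult_le_compat_l; [apply pow2_ge_0 | lra]. }
(* With y = th r, the exponent is at least y^2 / (4 (1 + y)), and y^2 >= (y - 1)(y + 1) bounds this
   below by (y - 1) / 4. *)
enough (th * r / 4 - 1 / 4 <= th ^ 2 * (r ^ 2 - D ^ 2) / (2 * (1 + th * D))) by lra.
apply Rmult_le_reg_r with (2 * (1 + th * D)); [lra|].
unfold Rdiv at 3; rewrite Rmult_assoc, Rinv_l by lra.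
destruct (Rle_lt_dec (th * r) 1); nra.
Qed.

Section Pointwise.
Variable k : nat.
Hypothesis Hk : (0 < k)%nat.
(** This is k^(-1/4). Shifting the mean by [eta * k] costs a Chebyshev error of order k / (eta k)^2
    = eta^2, while the shift relative to [k] is [eta]; both vanish as [k] grows. *)
Let eta := / sqrt (sqrt (INR k)).
Let y := INR k / a.

Lemma eta_bounds : 0 < eta <= 1 /\ eta ^ 4 * INR k = 1.
Proof.
assert (H1 : 1 <= INR k) by (apply (le_INR 1); lia).
assert (H2 : 1 <= sqrt (INR k)) by (rewrite <- sqrt_1; apply sqrt_le_1; lra).
assert (H3 : 1 <= sqrt (sqrt (INR k))) by (rewrite <- sqrt_1 at 1; apply sqrt_le_1; lra).
split; [split|].
- apply Rinv_0_lt_compat; lra.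
- unfold eta; rewrite <- Rinv_1; apply Rinv_le_contravar; lra.
- assert (H : sqrt (sqrt (INR k)) ^ 4 = INR k).
  { replace (sqrt (sqrt (INR k)) ^ 4) with ((sqrt (sqrt (INR k)) ^ 2) ^ 2) by ring.
    rewrite !pow2_sqrt; lra. }
  unfold eta; rewrite pow_inv, H; apply Rinv_l; lra.
Qed.

Lemma INR_k_eq : INR k = INR n * (y / r).
Proof.
rewrite <- scale_root; unfold y; field.
split; apply Rgt_not_eq; [apply scale_pos | apply root_pos].
Qed.

Lemma y_pos : 0 < y.
Proof. apply Rdiv_lt_0_compat; [apply lt_0_INR; lia | apply scale_pos]. Qed.

Lemma survival_upper : (1 - eta) * y * / r < 1 ->
  survival n d v k <=
  exp (- (((1 - eta) * y) ^ 2 * (1 - (D / r) ^ 2) / (2 * (1 + (1 - eta) * y * (D / r)))))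
  + eta ^ 2.
Proof.
intros Hlt; destruct eta_bounds as [Heta Heta4].
assert (Hr := root_pos); assert (Hy := y_pos); assert (Hn := INR_n_pos).
assert (Hk1 : 0 < INR k) by (apply lt_0_INR; lia).
set (th := (1 - eta) * y * / r).
assert (Hth : 0 <= th < 1).
{ split; [|exact Hlt]; apply Rmult_le_pos; [nra | apply Rlt_le, Rinv_0_lt_compat; lra]. }
assert (Hnth : INR n * th = (1 - eta) * INR k).
{ rewrite INR_k_eq; unfold th; field; lra. }
eapply Rle_trans.
{ apply (q_upper n (erased n d v) (survival n d v)) with (th := th); try lra.
  - apply length_erased.
  - intros; now apply survival_esym.
  - intros; now apply survival_decr.
  - intros; now apply survival_01.
  - rewrite Hnth; nra. }
apply Rplus_le_compat.
- eapply Rle_trans; [apply mix_erased_upper; assumption|].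
  apply exp_le_exp, Req_le; f_equal.
  assert (0 <= D) by apply pos_INR.
  assert (0 <= th * D) by (apply Rmult_le_pos; lra).
  unfold th in *; field; split; [lra|].
  replace (r + (1 - eta) * y * D) with (r * (1 + (1 - eta) * y * / r * D)) by (field; lra).
  apply Rgt_not_eq, Rmult_lt_0_compat; lra.
(* The variance term is [(1 - eta) / (eta ^ 2 * k)], and [eta ^ 4 * k = 1] makes it
   [(1 - eta) * eta ^ 2]. *)
- rewrite Hnth; replace (INR k - (1 - eta) * INR k) with (eta * INR k) by ring.
  replace ((1 - eta) * INR k / (eta * INR k) ^ 2) with ((1 - eta) * eta ^ 2).
  + nra.
  + replace ((eta * INR k) ^ 2) with (/ eta ^ 2 * INR k).
    * field; lra.
    * apply Rmult_eq_reg_l with (eta ^ 2); [|apply pow_nonzero; lra].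
      rewrite <- Rmult_assoc, Rinv_r by (apply pow_nonzero; lra).
      transitivity (eta ^ 4 * INR k * INR k); [rewrite Heta4; ring | ring].
Qed.

Lemma survival_lower : (1 + eta) * y * / r < 1 ->
  exp (- ((1 + eta) * y * (D / r))
       - ((1 + eta) * y) ^ 2 * (1 + (/ r) ^ 2) / (2 * (1 - (1 + eta) * y * / r)))
  - (1 + eta) * eta ^ 2 <= survival n d v k.
Proof.
intros Hlt; destruct eta_bounds as [Heta Heta4].
assert (Hr := root_pos); assert (Hy := y_pos); assert (Hn := INR_n_pos).
assert (Hk1 : 0 < INR k) by (apply lt_0_INR; lia).
set (th := (1 + eta) * y * / r) in *.
assert (Hth : 0 <= th < 1).
{ split; [|exact Hlt]; apply Rmult_le_pos; [nra | apply Rlt_le, Rinv_0_lt_compat; lra]. }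
assert (Hnth : INR n * th = (1 + eta) * INR k).
{ rewrite INR_k_eq; unfold th; field; lra. }
assert (Hq : mix th (erased n d v) (fun _ => 1) <=
             survival n d v k + INR n * th / (INR n * th - INR k) ^ 2).
{ apply (q_lower n (erased n d v) (survival n d v)); try lra.
  - apply length_erased.
  - intros; now apply survival_esym.
  - intros; now apply survival_decr.
  - intros; now apply survival_01.
  - rewrite Hnth; nra. }
assert (Hm := mix_erased_lower th Hth).
replace (th * D) with ((1 + eta) * y * (D / r)) in Hm by (unfold th; field; lra).
replace (th ^ 2 * (r ^ 2 + 1)) with (((1 + eta) * y) ^ 2 * (1 + (/ r) ^ 2)) in Hm
  by (unfold th; field; lra).
replace (INR n * th / (INR n * th - INR k) ^ 2) with ((1 + eta) * eta ^ 2) in Hq; [lra|].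
rewrite Hnth; replace ((1 + eta) * INR k - INR k) with (eta * INR k) by ring.
replace ((eta * INR k) ^ 2) with (/ eta ^ 2 * INR k).
- field; lra.
- apply Rmult_eq_reg_l with (eta ^ 2); [|apply pow_nonzero; lra].
  rewrite <- Rmult_assoc, Rinv_r by (apply pow_nonzero; lra).
  transitivity (eta ^ 4 * INR k * INR k); [rewrite Heta4; ring | ring].
Qed.

End Pointwise.
End Bounds.

(** Both bounds are expressions in [eta], [y], the ratio [rho] of maximal degree to [r], and [/ r],
    which tend to 0, x, 0 and 0. They therefore have the same limit. *)
Lemma survival_limit (d : nat -> nat -> nat) (v k : nat -> nat) (x : R) :
  0 < x ->
  eventually (fun n => is_degree_sequence n (d n) /\ (v n < n)%nat /\ 0 < sigma2 n (d n)) ->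
  is_lim_seq (fun n => sqrt (INR n / sigma2 n (d n))) p_infty ->
  is_lim_seq (fun n => sqrt (INR n * sigma2 n (d n))) p_infty ->
  is_lim_seq (fun n => INR (maxdeg n (d n)) / sqrt (INR n * sigma2 n (d n))) 0 ->
  is_lim_seq (fun n => INR (k n) / sqrt (INR n / sigma2 n (d n))) x ->
  is_lim_seq (fun n => survival n (d n) (v n) (k n)) (exp (- (x ^ 2 / 2))).
Proof.
intros Hx Hgood Ha Hr HD Hy.
set (a := fun n => sqrt (INR n / sigma2 n (d n))) in *.
set (r := fun n => sqrt (INR n * sigma2 n (d n))) in *.
set (rho := fun n => INR (maxdeg n (d n)) / r n) in *.
set (y := fun n => INR (k n) / a n) in *.
assert (Ha0 : eventually (fun n => 0 < a n)).
{ destruct Hgood as [N HN]; exists N; intros n Hn; destruct (HN n Hn) as (H1 & H2 & H3).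
  now apply (scale_pos n (d n) (v n)). }
assert (Hk : is_lim_seq (fun n => INR (k n)) p_infty).
(* Positivity of [x] enters here: it sends [k n] to infinity and hence [eta n] to 0. *)
{ apply is_lim_seq_ext_loc with (fun n => y n * a n).
  - destruct Ha0 as [N HN]; exists N; intros n Hn; unfold y; field.
    apply Rgt_not_eq, HN, Hn.
  - apply (is_lim_seq_mult _ _ x p_infty); [exact Hy | exact Ha |].
    apply is_Rbar_mult_sym, is_Rbar_mult_p_infty_pos; exact Hx. }
set (eta := fun n => / sqrt (sqrt (INR (k n)))).
assert (Heta : is_lim_seq eta 0).
{ apply (is_lim_seq_inv _ p_infty).
  - apply (filterlim_comp _ _ _ (fun n => sqrt (INR (k n))) sqrt _ (Rbar_locally p_infty));
      [|apply filterlim_sqrt_p].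
    apply (filterlim_comp _ _ _ (fun n => INR (k n)) sqrt _ (Rbar_locally p_infty));
      [exact Hk | apply filterlim_sqrt_p].
  - discriminate. }
assert (Hw : is_lim_seq (fun n => / r n) 0).
{ apply (is_lim_seq_inv _ p_infty); [exact Hr | discriminate]. }
assert (Hk0 : eventually (fun n => (0 < k n)%nat)).
{ apply is_lim_seq_spec in Hk; destruct (Hk 0) as [N HN].
  exists N; intros n Hn; apply INR_lt; simpl; auto. }
assert (Hzp : is_lim_seq (fun n => (1 + eta n) * y n) x).
{ replace (Finite x) with (Finite ((1 + 0) * x)) by (f_equal; ring).
  apply is_lim_seq_mult'; [apply is_lim_seq_plus'; [apply is_lim_seq_const|]|]; assumption. }
assert (Hzm : is_lim_seq (fun n => (1 - eta n) * y n) x).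
{ replace (Finite x) with (Finite ((1 - 0) * x)) by (f_equal; ring).
  apply is_lim_seq_mult'; [apply is_lim_seq_minus'; [apply is_lim_seq_const|]|]; assumption. }
assert (Hsq : forall u (l : R), is_lim_seq u l -> is_lim_seq (fun n => u n ^ 2) (l ^ 2)).
{ intros u l Hu; apply (is_lim_seq_continuous (fun t => t ^ 2)); [|exact Hu].
  apply derivable_continuous_pt, derivable_pt_pow. }
assert (Hexp : forall u (l : R), is_lim_seq u l -> is_lim_seq (fun n => exp (u n)) (exp l)).
{ intros u l Hu; apply (is_lim_seq_continuous exp); [|exact Hu].
  apply derivable_continuous_pt, derivable_pt_exp. }
assert (Hsmall : forall u, is_lim_seq u 0 -> eventually (fun n => u n < 1)).
{ intros u Hu; apply is_lim_seq_spec in Hu.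
  destruct (Hu (mkposreal 1 Rlt_0_1)) as [N HN]; exists N; intros n Hn.
  assert (H := HN n Hn); simpl in H; apply Rabs_def2 in H; lra. }
assert (Hzpw : is_lim_seq (fun n => (1 + eta n) * y n * / r n) 0).
{ replace (Finite 0) with (Finite (x * 0)) by (f_equal; ring).
  now apply is_lim_seq_mult'. }
assert (Hzmw : is_lim_seq (fun n => (1 - eta n) * y n * / r n) 0).
{ replace (Finite 0) with (Finite (x * 0)) by (f_equal; ring).
  now apply is_lim_seq_mult'. }
assert (Hlow := Hsmall _ Hzpw); assert (Hup := Hsmall _ Hzmw).
apply is_lim_seq_le_le_loc with
  (u := fun n => exp (- ((1 + eta n) * y n * rho n)
       - ((1 + eta n) * y n) ^ 2 * (1 + (/ r n) ^ 2) / (2 * (1 - (1 + eta n) * y n * / r n)))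
       - (1 + eta n) * eta n ^ 2)
  (w := fun n => exp (- (((1 - eta n) * y n) ^ 2 * (1 - rho n ^ 2)
       / (2 * (1 + (1 - eta n) * y n * rho n)))) + eta n ^ 2).
- generalize (filter_and _ _ Hgood (filter_and _ _ Hk0 (filter_and _ _ Hlow Hup))).
  apply filter_imp; intros n ((H1 & H2 & H3) & H4 & H5 & H6); split.
  + now apply survival_lower.
  + now apply survival_upper.
(* The limit is written as the lower bound at [eta = 0], [y = x], [rho = 0], [/ r = 0], to match the
   limit rules term by term. *)
- replace (exp (- (x ^ 2 / 2))) with
    (exp (- (x * 0) - x ^ 2 * (1 + 0 ^ 2) / (2 * (1 - 0))) - (1 + 0) * 0 ^ 2).
  2:{ replace (- (x * 0) - x ^ 2 * (1 + 0 ^ 2) / (2 * (1 - 0))) with (- (x ^ 2 / 2)) by field.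
      ring. }
  apply is_lim_seq_minus'.
  + apply Hexp, is_lim_seq_minus'.
    * apply (is_lim_seq_opp _ (x * 0)); now apply is_lim_seq_mult'.
    * apply is_lim_seq_div'; [| |lra].
      -- apply is_lim_seq_mult'; [now apply Hsq|].
         apply is_lim_seq_plus'; [apply is_lim_seq_const | now apply Hsq].
      -- apply is_lim_seq_mult'; [apply is_lim_seq_const|].
         apply is_lim_seq_minus'; [apply is_lim_seq_const | assumption].
  + apply is_lim_seq_mult'; [|now apply Hsq].
    apply is_lim_seq_plus'; [apply is_lim_seq_const | assumption].
- replace (exp (- (x ^ 2 / 2))) with
    (exp (- (x ^ 2 * (1 - 0 ^ 2) / (2 * (1 + x * 0)))) + 0 ^ 2).
  2:{ replace (x ^ 2 * (1 - 0 ^ 2) / (2 * (1 + x * 0))) with (x ^ 2 / 2)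
        by (rewrite Rmult_0_r; field).
      ring. }
  apply is_lim_seq_plus'; [|now apply Hsq].
  apply Hexp, (is_lim_seq_opp _ (x ^ 2 * (1 - 0 ^ 2) / (2 * (1 + x * 0)))).
  apply is_lim_seq_div'; [| |lra].
  + apply is_lim_seq_mult'; [now apply Hsq|].
    apply is_lim_seq_minus'; [apply is_lim_seq_const | now apply Hsq].
  + apply is_lim_seq_mult'; [apply is_lim_seq_const|].
    apply is_lim_seq_plus'; [apply is_lim_seq_const | now apply is_lim_seq_mult'].
Qed.

(** * Rayleigh moments and the Gaussian integral *)

(** Plays two roles: the Rayleigh survival function P(X > x), whose derivative is minus
    [rayleigh_density], and the Gaussian kernel whose integral gives the mean. *)
Definition gauss (x : R) : R := exp (- (x ^ 2 / 2)).

Lemma gauss_le_1 (x : R) : 0 < gauss x <= 1.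
Proof.
split; [apply exp_pos|]; rewrite <- exp_0; apply exp_le_exp.
assert (H := pow2_ge_0 x); lra.
Qed.

Lemma gauss_0 : gauss 0 = 1.
Proof. unfold gauss; replace (- (0 ^ 2 / 2)) with 0 by field; apply exp_0. Qed.

Lemma gauss_exp (b x : R) : gauss x <= exp (b ^ 2 / 2) * exp (- (b * x)).
Proof.
rewrite <- exp_plus; apply exp_le_exp.
assert (H := pow2_ge_0 (x - b)); lra.
Qed.

Lemma is_derive_gauss (x : R) : is_derive (fun t => - gauss t) x (rayleigh_density x).
Proof.
unfold gauss, rayleigh_density; auto_derive; [exact I|].
replace (- (x * (x * 1) * / 2)) with (- (x * x) / 2) by field; field.
Qed.

Lemma continuous_gauss (x : R) : continuous gauss x.
Proof. apply (ex_derive_continuous gauss); unfold gauss; auto_derive; exact I. Qed.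

Lemma continuous_density (x : R) : continuous rayleigh_density x.
Proof.
apply (ex_derive_continuous rayleigh_density); unfold rayleigh_density.
auto_derive; exact I.
Qed.

Lemma density_pos (x : R) : 0 <= x -> 0 <= rayleigh_density x.
Proof. intros H; apply Rmult_le_pos; [exact H | apply Rlt_le, exp_pos]. Qed.

Lemma density_eq (x : R) : rayleigh_density x = x * gauss x.
Proof.
unfold rayleigh_density, gauss.
now replace (- (x * x) / 2) with (- (x ^ 2 / 2)) by field.
 Qed.

Lemma RInt_density (x y : R) :
  is_RInt rayleigh_density x y (gauss x - gauss y).
Proof.
replace (gauss x - gauss y) with (minus (- gauss y) (- gauss x)).
- apply (is_RInt_derive (fun t => - gauss t)); intros; [apply is_derive_gauss | apply continuous_density].
- change (- gauss y - - gauss x = gauss x - gauss y); ring.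
Qed.

Lemma gauss_decr (x y : R) : 0 <= x <= y -> gauss y <= gauss x.
Proof. intros H; apply exp_le_exp; nra. Qed.

Lemma gauss_lipschitz (x y : R) : 0 <= x <= y -> gauss x - gauss y <= y - x.
Proof.
intros H.
rewrite <- (is_RInt_unique _ _ _ _ (RInt_density x y)).
replace (y - x) with (RInt (fun _ => 1) x y) by (rewrite RInt_const; apply Rmult_1_r).
apply RInt_le; [lra | eexists; apply RInt_density | apply ex_RInt_const |].
intros t Ht; rewrite density_eq.
assert (H1 := gauss_le_1 t).
assert (H2 : gauss t * exp (t ^ 2 / 2) = 1).
{ unfold gauss; rewrite <- exp_plus; replace (_ + _) with 0 by ring; apply exp_0. }
(* The density is at most 1 because exp (t^2 / 2) >= 1 + t^2 / 2 >= t. *)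
assert (H3 := exp_ineq1_le (t ^ 2 / 2)); nra.
Qed.

Lemma rpow_pos (x p : R) : 0 < x -> rpow x p = Rpower x p.
Proof. intros H; unfold rpow; destruct (Rle_dec x 0); [lra | reflexivity]. Qed.

Lemma rpow_0 (p : R) : rpow 0 p = 0.
Proof. unfold rpow; destruct (Rle_dec 0 0); lra. Qed.

Lemma rpow_ge_0 (x p : R) : 0 <= rpow x p.
Proof. unfold rpow; destruct (Rle_dec x 0); [lra | apply Rlt_le, exp_pos]. Qed.

Lemma rpow_le (x y p : R) : 0 <= p -> x <= y -> rpow x p <= rpow y p.
Proof.
intros Hp Hxy; destruct (Rle_dec x 0) as [Hx|Hx].
- unfold rpow at 1; destruct (Rle_dec x 0); [apply rpow_ge_0 | lra].
- rewrite !rpow_pos by lra; apply Rle_Rpower_l; lra.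
Qed.

Lemma rpow_1 (x : R) : 0 <= x -> rpow x 1 = x.
Proof. intros [H| <-]; [rewrite rpow_pos, Rpower_1; auto | apply rpow_0]. Qed.

Lemma rpow_2 (x : R) : 0 <= x -> rpow x 2 = x ^ 2.
Proof.
intros [H| <-]; [|rewrite rpow_0; ring].
rewrite rpow_pos by assumption; now rewrite <- (Rpower_pow 2 x).
Qed.

(** Apply ln z <= z to z = c x / p and multiply by [p]; this gives the constant B = (c / p)^(-p). *)
Lemma rpow_exp (p c : R) : 0 < p -> 0 < c ->
  exists B, 0 < B /\ forall x, 0 <= x -> rpow x p <= B * exp (c * x).
Proof.
intros Hp Hc; exists (exp (- (p * ln (c / p)))); split; [apply exp_pos|].
intros x [Hx| <-].
2:{ rewrite rpow_0; apply Rlt_le, Rmult_lt_0_compat; apply exp_pos. }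
assert (Hcp : 0 < c / p) by (apply Rdiv_lt_0_compat; lra).
rewrite rpow_pos, <- exp_plus by assumption; apply exp_le_exp.
assert (Hln : ln (c / p * x) <= c / p * x).
{ assert (H := exp_ineq1_le (ln (c / p * x))).
  rewrite exp_ln in H; [lra | now apply Rmult_lt_0_compat]. }
rewrite ln_mult in Hln by assumption.
apply (Rmult_le_compat_l p) in Hln; [|lra].
replace (p * (c / p * x)) with (c * x) in Hln by (field; lra).
lra.
Qed.

Lemma continuous_rpow (p x : R) : 0 < p -> continuous (fun t => rpow t p) x.
Proof.
intros Hp; destruct (Rtotal_order x 0) as [Hx|[-> |Hx]].
- apply (continuous_ext_loc _ (fun _ => 0)); [|apply continuous_const].
  exists (mkposreal (- x) ltac:(lra)); intros y Hy.
  apply Rabs_def2 in Hy; change (y - x < - x /\ - - x < y - x) in Hy.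
  unfold rpow; destruct (Rle_dec y 0); [reflexivity | lra].
- apply filterlim_locally; intros [e He].
  exists (mkposreal (Rpower e (/ p)) (exp_pos _)); intros y Hy.
  change (Rabs (y - 0) < Rpower e (/ p)) in Hy; change (Rabs (rpow y p - rpow 0 p) < e).
  rewrite rpow_0, Rminus_0_r, Rabs_pos_eq by apply rpow_ge_0; rewrite Rminus_0_r in Hy.
  destruct (Rle_dec y 0) as [Hy0|Hy0].
  + unfold rpow; destruct (Rle_dec y 0); [exact He | lra].
  + rewrite Rabs_pos_eq in Hy by lra; rewrite rpow_pos by lra.
    replace e with (Rpower (Rpower e (/ p)) p).
    * apply Rlt_Rpower_l; lra.
    * rewrite Rpower_mult, Rinv_l, Rpower_1; lra.
- apply (continuous_ext_loc _ (fun t => exp (p * ln t))).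
  + exists (mkposreal x Hx); intros y Hy; apply Rabs_def2 in Hy.
    change (y - x < x /\ - x < y - x) in Hy; symmetry; apply rpow_pos; lra.
  + apply (ex_derive_continuous (fun t => exp (p * ln t))); auto_derive; exact Hx.
Qed.

Definition partial_moment (p M : R) : R := RInt (fun x => rpow x p * rayleigh_density x) 0 M.

Lemma ex_RInt_moment (p x y : R) : 0 < p ->
  ex_RInt (fun x => rpow x p * rayleigh_density x) x y.
Proof.
intros Hp; apply (ex_RInt_continuous (fun x => rpow x p * rayleigh_density x)); intros z _.
apply (continuous_mult (fun x => rpow x p)); [now apply continuous_rpow | apply continuous_density].
Qed.

Lemma partial_moment_split (p x y : R) : 0 < p ->
  partial_moment p y = partial_moment p x + RInt (fun x => rpow x p * rayleigh_density x) x y.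
Proof.
intros Hp; unfold partial_moment.
rewrite <- (RInt_Chasles _ 0 x y) by now apply ex_RInt_moment.
reflexivity.
Qed.

(** The Rayleigh law gives the interval mass [gauss x - gauss y], and [rpow] is monotone on it. *)
Lemma partial_moment_step (p x y : R) : 0 < p -> 0 <= x <= y ->
  rpow x p * (gauss x - gauss y) <= partial_moment p y - partial_moment p x
    <= rpow y p * (gauss x - gauss y).
Proof.
intros Hp Hxy; rewrite (partial_moment_split p x y) by assumption.
enough (rpow x p * (gauss x - gauss y) <= RInt (fun x => rpow x p * rayleigh_density x) x y
    <= rpow y p * (gauss x - gauss y)) by lra.
assert (Hc : forall c, is_RInt (fun t => c * rayleigh_density t) x y (c * (gauss x - gauss y))).
{ intros c; apply (is_RInt_scal rayleigh_density), RInt_density. }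
split.
- rewrite <- (is_RInt_unique _ _ _ _ (Hc (rpow x p))).
  apply RInt_le; [lra | eexists; apply Hc | now apply ex_RInt_moment |].
  intros t Ht; apply Rmult_le_compat_r; [apply density_pos; lra | apply rpow_le; lra].
- rewrite <- (is_RInt_unique _ _ _ _ (Hc (rpow y p))).
  apply RInt_le; [lra | now apply ex_RInt_moment | eexists; apply Hc |].
  intros t Ht; apply Rmult_le_compat_r; [apply density_pos; lra | apply rpow_le; lra].
Qed.

Lemma partial_moment_mono (p x y : R) : 0 < p -> 0 <= x <= y ->
  partial_moment p x <= partial_moment p y.
Proof.
intros Hp Hxy; destruct (partial_moment_step p x y Hp Hxy) as [H _].
assert (H1 := gauss_decr x y Hxy); assert (H2 := rpow_ge_0 x p); nra.
Qed.

Lemma partial_moment_bounded (p : R) : 0 < p ->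
  exists B, forall M, 0 <= M -> partial_moment p M <= B.
Proof.
intros Hp; destruct (rpow_exp p 1 Hp Rlt_0_1) as (B & HB & Hgrowth).
(* Both x^p and the factor x of the density grow at most like e^x; taking [b = 3] in [gauss_exp]
   still leaves e^(-x), whose integral is at most 1. *)
exists (B * exp (3 ^ 2 / 2)); intros M HM.
set (C := B * exp (3 ^ 2 / 2)).
assert (HC : 0 < C) by (apply Rmult_lt_0_compat; [exact HB | apply exp_pos]).
assert (Hint : is_RInt (fun t => C * exp (- t)) 0 M (C - C * exp (- M))).
{ replace (C - C * exp (- M)) with (minus (- (C * exp (- M))) (- (C * exp (- 0)))).
  - apply (is_RInt_derive (fun t => - (C * exp (- t)))).
    + intros t _; auto_derive; [exact I | ring].
    + intros t _; apply (ex_derive_continuous (fun t => C * exp (- t))); auto_derive; exact I.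
  - rewrite Ropp_0, exp_0; change (- (C * exp (- M)) - - (C * 1) = C - C * exp (- M)); ring. }
apply Rle_trans with (C - C * exp (- M)).
2:{ assert (H := exp_pos (- M)); nra. }
rewrite <- (is_RInt_unique _ _ _ _ Hint).
apply RInt_le; [lra | now apply ex_RInt_moment | eexists; exact Hint |].
intros t Ht; rewrite density_eq.
assert (H1 := Hgrowth t ltac:(lra)); assert (H2 := gauss_exp 3 t).
assert (H3 := exp_ineq1_le t); assert (H4 := gauss_le_1 t); assert (H5 := rpow_ge_0 t p).
replace (C * exp (- t)) with ((B * exp (1 * t)) * (exp t * (exp (3 ^ 2 / 2) * exp (- (3 * t))))).
- apply Rmult_le_compat; [exact H5 | nra | exact H1 |].
  apply Rmult_le_compat; lra.
- unfold C; rewrite <- !exp_plus.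
  rewrite !Rmult_assoc, <- !exp_plus; do 2 f_equal; field.
Qed.

(** Monotone and bounded, so the supremum is the limit. Existence of the moment is enough for
    general [p]; a closed form is computed only for orders 1 and 2. *)
Lemma partial_moment_limit (p : R) : 0 < p ->
  exists l : R, is_lim (partial_moment p) p_infty l.
Proof.
intros Hp; destruct (partial_moment_bounded p Hp) as [B HB].
destruct (completeness (fun y => exists M, 0 <= M /\ y = partial_moment p M)) as [l [Hub Hlub]].
- exists B; intros y (M & HM & ->); now apply HB.
- exists (partial_moment p 0), 0; split; [lra | reflexivity].
- exists l; apply is_lim_spec; intros [e He]; simpl.
  assert (Hex : exists M, 0 <= M /\ l - e < partial_moment p M).
  { apply Classical_Prop.NNPP; intros Hn.
    assert (Hle : l <= l - e); [|lra].
    apply Hlub; intros y (M & HM & ->).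
    apply Rnot_lt_le; intros Hlt; apply Hn; now exists M. }
  destruct Hex as (M & HM & Hlt); exists M; intros M' HM'.
  assert (H1 := partial_moment_mono p M M' Hp ltac:(lra)).
  assert (H2 : partial_moment p M' <= l) by (apply Hub; exists M'; split; [lra | reflexivity]).
  apply Rabs_def1; lra.
Qed.

Lemma rayleigh_moment_limit (p l : R) : 0 < p ->
  is_lim (partial_moment p) p_infty l -> rayleigh_moment p l.
Proof.
intros Hp Hl; split.
- intros M _; constructor; now apply ex_RInt_Reals_0, ex_RInt_moment.
- intros e He; apply is_lim_spec in Hl.
  destruct (Hl (mkposreal e He)) as [M0 HM0]; exists (M0 + 1); intros M pr HM.
  rewrite <- (RInt_Reals _ _ _ pr); apply HM0; lra.
Qed.

Lemma is_lim_exp_decay (C c : R) : 0 < c -> is_lim (fun x => C * exp (- (c * x))) p_infty 0.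
Proof.
intros Hc; replace (Finite 0) with (Rbar_mult C 0) by (simpl; f_equal; ring).
apply is_lim_scal_l.
apply (is_lim_comp exp (fun x => - (c * x)) p_infty 0 m_infty).
- apply is_lim_exp_m.
- replace m_infty with (Rbar_opp p_infty) by reflexivity; apply is_lim_opp.
  assert (H := is_lim_scal_l (fun x => x) c p_infty p_infty (is_lim_id _)).
  replace (Rbar_mult c p_infty) with p_infty in H; [exact H|].
  symmetry; apply is_Rbar_mult_unique, is_Rbar_mult_sym, is_Rbar_mult_p_infty_pos; exact Hc.
- exists 0; intros; discriminate.
Qed.

Lemma is_lim_squeeze_0 (f g : R -> R) : is_lim g p_infty 0 ->
  (forall x, 0 < x -> Rabs (f x) <= g x) -> is_lim f p_infty 0.
Proof.
intros Hg Hfg; apply is_lim_spec; intros e; apply is_lim_spec in Hg.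
destruct (Hg e) as [M HM]; exists (Rmax M 0); intros x Hx.
assert (Hx1 := HM x (Rle_lt_trans _ _ _ (Rmax_l _ _) Hx)).
assert (Hx2 := Hfg x (Rle_lt_trans _ _ _ (Rmax_r _ _) Hx)).
rewrite Rminus_0_r in *; assert (H := Rle_abs (g x)); lra.
Qed.

Lemma rpow_gauss_limit (p : R) : 0 < p -> is_lim (fun x => rpow x p * gauss x) p_infty 0.
Proof.
intros Hp; destruct (rpow_exp p 1 Hp Rlt_0_1) as (B & HB & Hgrowth).
apply (is_lim_squeeze_0 _ (fun x => B * exp (2 ^ 2 / 2) * exp (- (1 * x)))).
- apply is_lim_exp_decay; lra.
- intros x Hx; assert (H4 := gauss_le_1 x); assert (H5 := rpow_ge_0 x p).
  rewrite Rabs_pos_eq by (apply Rmult_le_pos; lra).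
  replace (B * exp (2 ^ 2 / 2) * exp (- (1 * x)))
    with (B * exp (1 * x) * (exp (2 ^ 2 / 2) * exp (- (2 * x)))).
  + apply Rmult_le_compat; try lra; [apply Hgrowth; lra | apply gauss_exp].
  + rewrite !Rmult_assoc, <- !exp_plus; do 2 f_equal; field.
Qed.

(** * Exact values of the first two Rayleigh moments *)

Lemma partial_moment_2 : is_lim (partial_moment 2) p_infty 2.
Proof.
(* The last summand is just [2 * gauss x], split by a factor exp (- x / 2) exp (x / 2) = 1 so that
   it can be squeezed by an exponential. *)
apply (is_lim_ext_loc (fun x => 2 - (rpow x 2 * gauss x +
  2 * exp (- (/ 2 * x)) * (gauss x * exp (/ 2 * x))))).
- exists 0; intros M HM; unfold partial_moment.
  rewrite (RInt_ext _ (fun x => x ^ 2 * rayleigh_density x)).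
  2:{ intros x; rewrite Rmin_left by lra; intros Hx; rewrite rpow_2 by lra; reflexivity. }
  symmetry; apply is_RInt_unique.
  replace (2 - _) with (minus (- ((M ^ 2 + 2) * gauss M)) (- ((0 ^ 2 + 2) * gauss 0))).
  (* Explicit antiderivative: (- (x^2 + 2) gauss x)' = x^3 gauss x. *)
  + apply (is_RInt_derive (fun x => - ((x ^ 2 + 2) * gauss x))).
    * intros x _; rewrite density_eq; unfold gauss; auto_derive; [exact I|].
      replace (- (x * (x * 1) * / 2)) with (- (x ^ 2 / 2)) by (simpl; field); field.
    * intros x _; apply (continuous_mult (fun x => x ^ 2)).
      -- apply (ex_derive_continuous (fun x => x ^ 2)); auto_derive; exact I.
      -- apply continuous_density.
  + rewrite gauss_0, rpow_2 by lra; replace (2 * exp (- (/ 2 * M)) * (gauss M * exp (/ 2 * M)))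
      with (2 * gauss M * (exp (- (/ 2 * M)) * exp (/ 2 * M))) by ring.
    rewrite <- exp_plus, Rplus_opp_l, exp_0.
    change (- ((M ^ 2 + 2) * gauss M) - - ((0 ^ 2 + 2) * 1) = 2 - (M ^ 2 * gauss M + 2 * gauss M * 1)).
    ring.
- replace (Finite 2) with (Finite (2 - (0 + 0))) by (f_equal; ring).
  apply is_lim_minus'; [apply is_lim_const|].
  apply is_lim_plus'; [apply rpow_gauss_limit; lra|].
  apply (is_lim_squeeze_0 _ (fun x => 2 * exp (1 ^ 2 / 2) * exp (- (/ 2 * x)))).
  + apply is_lim_exp_decay; lra.
  + intros x Hx; assert (H1 := gauss_exp 1 x); assert (H2 := gauss_le_1 x).
    assert (H3 := exp_pos (/ 2 * x)); assert (H4 := exp_pos (- (/ 2 * x))).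
    rewrite Rabs_pos_eq by (repeat apply Rmult_le_pos; lra).
    replace (2 * exp (1 ^ 2 / 2) * exp (- (/ 2 * x)))
      with (2 * exp (- (/ 2 * x)) * exp (1 ^ 2 / 2)) by ring.
    apply Rmult_le_compat_l; [lra|].
    apply Rle_trans with (exp (1 ^ 2 / 2) * exp (- (1 * x)) * exp (/ 2 * x)).
    * apply Rmult_le_compat_r; lra.
    * rewrite Rmult_assoc, <- exp_plus.
      rewrite <- (Rmult_1_r (exp (1 ^ 2 / 2))) at 2.
      apply Rmult_le_compat_l; [apply Rlt_le, exp_pos|].
      apply Rle_trans with (exp 0); [apply exp_le_exp; lra | rewrite exp_0; lra].
Qed.

Lemma RInt_gauss_derive (x : R) : is_derive (RInt gauss 0) x (gauss x).
Proof.
apply (is_derive_RInt gauss _ 0).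
- apply filter_forall; intros y; apply (RInt_correct gauss).
  apply (ex_RInt_continuous gauss); intros z _; apply continuous_gauss.
- apply continuous_gauss.
Qed.

(* With [B x = RInt (aux_kernel x) 0 1], the function [(RInt gauss 0 x)^2 + 2 B x] is
   constant, and [B] vanishes at infinity; its value at 0 is [2 atan 1 = PI / 2]. *)
Definition aux_kernel (x t : R) : R := exp (- (x ^ 2 * (1 + t ^ 2) / 2)) / (1 + t ^ 2).

Lemma aux_kernel_derive (x t : R) :
  is_derive (fun u => aux_kernel u t) x (- (x * exp (- (x ^ 2 * (1 + t ^ 2) / 2)))).
Proof.
unfold aux_kernel; assert (H := pow2_ge_0 t); simpl in H.
auto_derive; [lra|].
replace (- (x * (x * 1) * (1 + t * (t * 1)) * / 2)) with (- (x ^ 2 * (1 + t ^ 2) / 2))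
  by (simpl; field).
field; simpl; lra.
Qed.

Lemma aux_kernel_continuous (x t : R) : continuous (aux_kernel x) t.
Proof.
apply (ex_derive_continuous (aux_kernel x)); unfold aux_kernel.
assert (H := pow2_ge_0 t); simpl in H; auto_derive; lra.
Qed.

(** Differentiating under the integral cancels the denominator [1 + t ^ 2]. The exponential then
    splits into [gauss x] and [gauss (x * t)], and the substitution s = x t gives the integral of
    [gauss] up to [x]. *)
Lemma aux_derive (x : R) :
  is_derive (fun u => RInt (aux_kernel u) 0 1) x (- (gauss x * RInt gauss 0 x)).
Proof.
assert (H := is_derive_RInt_param aux_kernel 0 1 x).
replace (- (gauss x * RInt gauss 0 x))
  with (RInt (fun t => Derive (fun u => aux_kernel u t) x) 0 1).
- apply H.
  + apply filter_forall; intros y t _; eexists; apply aux_kernel_derive.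
  + intros t _.
    apply (continuity_2d_pt_ext (fun u s => - (u * exp (- (u ^ 2 * (1 + s ^ 2) / 2))))).
    * intros u s; symmetry; apply is_derive_unique, aux_kernel_derive.
    * apply continuity_2d_pt_opp, continuity_2d_pt_mult; [apply continuity_2d_pt_id1|].
      apply (continuity_1d_2d_pt_comp exp); [apply derivable_continuous_pt, derivable_pt_exp|].
      apply continuity_2d_pt_opp, continuity_2d_pt_mult; [|apply continuity_2d_pt_const].
      apply continuity_2d_pt_mult.
      -- apply (continuity_1d_2d_pt_comp (fun u => u ^ 2)); [|apply continuity_2d_pt_id1].
         apply derivable_continuous_pt, derivable_pt_pow.
      -- apply continuity_2d_pt_plus; [apply continuity_2d_pt_const|].
         apply (continuity_1d_2d_pt_comp (fun u => u ^ 2)); [|apply continuity_2d_pt_id2].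
         apply derivable_continuous_pt, derivable_pt_pow.
  + apply filter_forall; intros y; apply (ex_RInt_continuous (aux_kernel y)); intros z _.
    apply aux_kernel_continuous.
(* The [+ 0] puts the argument in the affine form of [is_RInt_comp_lin]. *)
- rewrite (RInt_ext _ (fun t => - gauss x * (x * gauss (x * t + 0)))).
  2:{ intros t _; transitivity (- (x * exp (- (x ^ 2 * (1 + t ^ 2) / 2)))).
      { apply is_derive_unique, aux_kernel_derive. }
      match goal with |- ?l = ?r => change (@eq R l r) end.
      unfold gauss; replace (- (x ^ 2 * (1 + t ^ 2) / 2))
        with (- (x ^ 2 / 2) + - ((x * t + 0) ^ 2 / 2)) by field.
      rewrite exp_plus; ring. }
  assert (Hg : forall b, ex_RInt gauss 0 b).
  { intros b; apply (ex_RInt_continuous gauss); intros z _; apply continuous_gauss. }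
  apply is_RInt_unique; replace (- (gauss x * RInt gauss 0 x)) with (- gauss x * RInt gauss 0 x).
  + apply (is_RInt_scal (fun t => x * gauss (x * t + 0))), (is_RInt_comp_lin gauss).
    replace (x * 0 + 0) with 0 by ring; replace (x * 1 + 0) with x by ring.
    apply (RInt_correct gauss), Hg.
  + change (- gauss x * (RInt gauss 0 x : R) = - (gauss x * (RInt gauss 0 x : R))); ring.
Qed.

Lemma RInt_gauss_square (x : R) : 0 < x ->
  RInt gauss 0 x ^ 2 + 2 * RInt (aux_kernel x) 0 1 = PI / 2.
Proof.
intros Hx.
set (F := fun u : R => (RInt gauss 0 u : R) ^ 2 + 2 * (RInt (aux_kernel u) 0 1 : R)).
transitivity (F 0).
- symmetry; apply (eq_is_derive F 0 x); [|exact Hx]; intros t _.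
  assert (H1 := RInt_gauss_derive t); assert (H2 := aux_derive t).
  replace (zero : R_NormedModule) with
    (2 * (RInt gauss 0 t : R) ^ 1 * gauss t + 2 * (- (gauss t * (RInt gauss 0 t : R))))
    by (change (zero : R_NormedModule) with 0; ring).
  apply (is_derive_plus (fun u => (RInt gauss 0 u : R) ^ 2)
    (fun u => 2 * (RInt (aux_kernel u) 0 1 : R))).
  + replace (2 * (RInt gauss 0 t : R) ^ 1 * gauss t)
      with (INR 2 * gauss t * (RInt gauss 0 t : R) ^ Nat.pred 2)
      by (simpl; ring).
    apply (is_derive_pow (RInt gauss 0)), H1.
  + apply (is_derive_scal (fun u => RInt (aux_kernel u) 0 1)), H2.
- unfold F; rewrite RInt_point.
  assert (H : is_RInt (aux_kernel 0) 0 1 (PI / 4)).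
  { rewrite <- atan_1.
    replace (atan 1) with (minus (atan 1) (atan 0))
      by (rewrite atan_0; change (atan 1 - 0 = atan 1); ring).
    apply (is_RInt_derive atan); [|intros t _; apply aux_kernel_continuous].
    intros t _; replace (aux_kernel 0 t) with (/ (1 + Rsqr t)); [apply is_derive_atan|].
    unfold aux_kernel; replace (- (0 ^ 2 * (1 + t ^ 2) / 2)) with 0 by field.
    rewrite exp_0; unfold Rsqr, Rdiv; rewrite Rmult_1_l; f_equal; ring. }
  rewrite (is_RInt_unique _ _ _ _ H); change (0 ^ 2 + 2 * (PI / 4) = PI / 2); field.
Qed.

Lemma RInt_gauss_limit : is_lim (RInt gauss 0) p_infty (sqrt (PI / 2)).
Proof.
apply (is_lim_ext_loc (fun x => sqrt (PI / 2 - 2 * (RInt (aux_kernel x) 0 1 : R)))).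
- exists 0; intros x Hx; rewrite <- (RInt_gauss_square x Hx).
  replace (_ - _) with ((RInt gauss 0 x : R) ^ 2) by ring.
  apply sqrt_pow2, RInt_ge_0; [lra | |].
  + apply (ex_RInt_continuous gauss); intros z _; apply continuous_gauss.
  + intros t _; apply Rlt_le, gauss_le_1.
- assert (H : is_lim (fun x => PI / 2 - 2 * (RInt (aux_kernel x) 0 1 : R)) p_infty (PI / 2)).
  { replace (Finite (PI / 2)) with (Finite (PI / 2 - 2 * 0)) by (f_equal; ring).
    apply is_lim_minus'; [apply is_lim_const|].
    apply (is_lim_scal_l _ 2 p_infty 0).
    apply (is_lim_squeeze_0 _ (fun x => exp (1 ^ 2 / 2) * exp (- (1 * x)))).
    - apply is_lim_exp_decay; lra.
    - intros x Hx.
      assert (Hex : ex_RInt (aux_kernel x) 0 1).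
      { apply (ex_RInt_continuous (aux_kernel x)); intros z _; apply aux_kernel_continuous. }
      (* Since [1 + t ^ 2 >= 1], both the exponent and the denominator allow a bound by [gauss x],
         uniform in [t]. *)
      assert (Hker : forall t, 0 <= aux_kernel x t <= gauss x).
      { intros t; assert (Ht := pow2_ge_0 t); unfold aux_kernel.
        assert (He := exp_pos (- (x ^ 2 * (1 + t ^ 2) / 2))).
        split; [apply Rdiv_le_0_compat; lra|].
        apply Rle_trans with (exp (- (x ^ 2 * (1 + t ^ 2) / 2))).
        - apply Rmult_le_reg_r with (1 + t ^ 2); [lra|].
          unfold Rdiv; rewrite Rmult_assoc, Rinv_l by lra; nra.
        - apply exp_le_exp; assert (Hx2 := pow2_ge_0 x); nra. }
      rewrite Rabs_pos_eq.
      + apply Rle_trans with (gauss x); [|apply gauss_exp].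
        replace (gauss x) with (RInt (fun _ => gauss x) 0 1)
          by (rewrite RInt_const; change ((1 - 0) * gauss x = gauss x); ring).
        apply RInt_le; [lra | exact Hex | apply ex_RInt_const | intros; apply Hker].
      + apply RInt_ge_0; [lra | exact Hex | intros; apply Hker]. }
  apply (filterlim_comp _ _ _ (fun x => PI / 2 - 2 * (RInt (aux_kernel x) 0 1 : R)) sqrt
           _ (locally (PI / 2))); [exact H | apply continuous_sqrt].
Qed.

Lemma partial_moment_1 : is_lim (partial_moment 1) p_infty (sqrt (PI / 2)).
Proof.
apply (is_lim_ext_loc (fun x => (RInt gauss 0 x : R) - rpow x 1 * gauss x)).
- exists 0; intros M HM; unfold partial_moment.
  rewrite (RInt_ext (fun x => rpow x 1 * rayleigh_density x) (fun x => x * rayleigh_density x)).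
  2:{ intros x; rewrite Rmin_left by lra; intros Hx; rewrite rpow_1 by lra; reflexivity. }
  symmetry; apply is_RInt_unique; rewrite rpow_1 by lra.
  assert (Hg : is_RInt gauss 0 M (RInt gauss 0 M)).
  { apply (RInt_correct gauss), (ex_RInt_continuous gauss); intros z _; apply continuous_gauss. }
  (* Integration by parts: the integrand x^2 gauss x minus [gauss x] is the derivative of - x gauss
     x. *)
  assert (Hd : is_RInt (fun x => x * rayleigh_density x - gauss x) 0 M
                 (minus (- (M * gauss M)) (- (0 * gauss 0)))).
  { apply (is_RInt_derive (fun x => - (x * gauss x))).
    - intros x _; rewrite density_eq; unfold gauss; auto_derive; [exact I|].
      replace (- (x * (x * 1) * / 2)) with (- (x ^ 2 / 2)) by (simpl; field); field.
    - intros x _; apply (ex_derive_continuous (fun x => x * rayleigh_density x - gauss x)).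
      unfold rayleigh_density, gauss; auto_derive; exact I. }
  assert (H := is_RInt_plus _ _ _ _ _ _ Hg Hd).
  replace ((RInt gauss 0 M : R) - M * gauss M)
    with (plus (RInt gauss 0 M) (minus (- (M * gauss M)) (- (0 * gauss 0)))).
  + apply (is_RInt_ext (fun x => plus (gauss x) (x * rayleigh_density x - gauss x))); [|exact H].
    intros x _; change (gauss x + (x * rayleigh_density x - gauss x) = x * rayleigh_density x); ring.
  + change ((RInt gauss 0 M : R) + (- (M * gauss M) - - (0 * gauss 0)) =
      (RInt gauss 0 M : R) - M * gauss M).
    ring.
- replace (Finite (sqrt (PI / 2))) with (Finite (sqrt (PI / 2) - 0)) by (f_equal; ring).
  apply is_lim_minus'; [apply RInt_gauss_limit | apply rpow_gauss_limit; lra].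
Qed.

(** * Convergence of moments *)

Definition nat_floor (x : R) : nat := Z.to_nat (Int_part x).

Lemma nat_floor_spec (x : R) : 0 <= x -> INR (nat_floor x) <= x < INR (nat_floor x) + 1.
Proof.
intros Hx; destruct (base_Int_part x) as [H1 H2].
assert (H0 : (0 <= Int_part x)%Z).
{ apply Z.lt_succ_r, lt_IZR; unfold Z.succ; rewrite plus_IZR; simpl; lra. }
unfold nat_floor; rewrite INR_IZR_INZ, Z2Nat.id by exact H0; lra.
Qed.

(** The weight of P(s > k) when the p-th moment of s / a is summed by parts. *)
Definition power_step (a p : R) (k : nat) : R := rpow (INR (S k) / a) p - rpow (INR k / a) p.

Lemma power_step_ge_0 (a p : R) (k : nat) : 0 < a -> 0 <= p -> 0 <= power_step a p k.
Proof.
intros Ha Hp; unfold power_step.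
enough (rpow (INR k / a) p <= rpow (INR (S k) / a) p) by lra.
apply rpow_le; [exact Hp|]; apply Rmult_le_compat_r; [apply Rlt_le, Rinv_0_lt_compat, Ha|].
rewrite S_INR; lra.
Qed.

Lemma psum_power_step (a p : R) (K : nat) : psum (power_step a p) K = rpow (INR K / a) p.
Proof.
unfold power_step; rewrite (psum_telescope (fun k => rpow (INR k / a) p)).
simpl INR; unfold Rdiv; rewrite Rmult_0_l, rpow_0; ring.
Qed.

(* Abel summation turns the sum into a Riemann-Stieltjes sum of [x^p] against [- d gauss]. *)
Lemma power_step_gauss (a p : R) (K : nat) : 0 < a -> 0 < p ->
  Rabs (psum (fun k => power_step a p k * gauss (INR k / a)) K
        - (rpow (INR K / a) p * gauss (INR K / a) + partial_moment p (INR K / a)))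
  <= rpow (INR K / a) p / a.
Proof.
intros Ha Hp.
assert (Hmono : forall k, 0 <= INR k / a <= INR (S k) / a).
{ intros k; split; [apply Rdiv_le_0_compat; [apply pos_INR | exact Ha]|].
  apply Rmult_le_compat_r; [apply Rlt_le, Rinv_0_lt_compat, Ha | rewrite S_INR; lra]. }
assert (H0 : INR 0 / a = 0) by (simpl; unfold Rdiv; ring).
(* The error is nonnegative. One step adds [g1 * (h0 - h1)] minus the increment of the partial
   moment, which lies between 0 and [(g1 - g0) * (h0 - h1) <= (g1 - g0) / a] and telescopes. *)
assert (Hbound : 0 <= psum (fun k => power_step a p k * gauss (INR k / a)) K
        - (rpow (INR K / a) p * gauss (INR K / a) + partial_moment p (INR K / a))
   <= rpow (INR K / a) p / a).
{ induction K as [|K IH].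
  - cbn [psum]; rewrite H0, rpow_0; unfold partial_moment; rewrite RInt_point.
    change (0 <= 0 - (0 * gauss 0 + 0) <= 0 / a); unfold Rdiv; lra.
  - cbn [psum].
    assert (Hstep := partial_moment_step p _ _ Hp (Hmono K)).
    assert (Hlip := gauss_lipschitz _ _ (Hmono K)).
    replace (INR (S K) / a - INR K / a) with (/ a) in Hlip by (rewrite S_INR; field; lra).
    assert (Hps := power_step_ge_0 a p K Ha (Rlt_le _ _ Hp)).
    set (P := psum _ K) in *; unfold power_step in *.
    set (g0 := rpow (INR K / a) p) in *; set (g1 := rpow (INR (S K) / a) p) in *.
    set (h0 := gauss (INR K / a)) in *; set (h1 := gauss (INR (S K) / a)) in *.
    change (g0 / a) with (g0 * / a) in IH; change (g1 / a) with (g1 * / a).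
    assert (Hprod : (g1 - g0) * (h0 - h1) <= (g1 - g0) * / a) by (apply Rmult_le_compat_l; lra).
    set (ia := / a) in *; lra. }
rewrite Rabs_pos_eq; lra.
Qed.

(** The exponential is split into two equal factors [s k]: one absorbs the growth of x^p, the other
    is summed by parts. The bound is uniform in [N]; [1 <= a] keeps consecutive values of [s] within
    the factor [exp (c / 2)]. *)
Lemma psum_tail (a c C B p : R) (q : nat -> R) (K N : nat) :
  1 <= a -> 0 < c -> 0 <= C -> 0 < B -> 0 <= p ->
  (forall x, 0 <= x -> rpow x p <= B * exp (c / 2 * x)) ->
  (forall k, q k <= C * exp (- (c * (INR k / a)))) ->
  psum (fun k => power_step a p (K + k) * q (K + k)%nat) N <=
  2 * (B * C * exp (c / 2)) * exp (- (c / 2 * (INR K / a))).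
Proof.
intros Ha Hc HC HB Hp Hg Hq.
set (E := B * C * exp (c / 2)); set (s := fun k => exp (- (c / 2 * (INR k / a)))).
set (g := fun k => rpow (INR k / a) p).
assert (Hs0 : forall k, 0 < s k) by (intros; apply exp_pos).
assert (Hsq : forall k, exp (- (c * (INR k / a))) = s k ^ 2).
{ intros k; unfold s; simpl; rewrite Rmult_1_r, <- exp_plus; f_equal; field; lra. }
assert (Hx : forall k, 0 <= INR k / a)
  by (intros; apply Rdiv_le_0_compat; [apply pos_INR | lra]).
assert (Hgs : forall k, g k * s k <= B).
{ intros k; apply Rle_trans with (B * exp (c / 2 * (INR k / a)) * s k).
  - apply Rmult_le_compat_r; [apply Rlt_le, Hs0 | apply Hg, Hx].
  - unfold s; rewrite Rmult_assoc, <- exp_plus, Rplus_opp_r, exp_0; lra. }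
assert (Hss : forall k, s k <= exp (c / 2) * s (S k) /\ s (S k) <= s k).
{ intros k.
  assert (Hia : 0 < / a <= 1) by (split; [apply Rinv_0_lt_compat; lra|];
    rewrite <- Rinv_1; apply Rinv_le_contravar; lra).
  assert (HS : INR (S k) / a = INR k / a + / a) by (rewrite S_INR; field; lra).
  assert (H1 : 0 <= c / 2 * / a) by (apply Rmult_le_pos; lra).
  assert (H2 : c / 2 * / a <= c / 2 * 1) by (apply Rmult_le_compat_l; lra).
  unfold s; rewrite HS; split; [rewrite <- exp_plus|]; apply exp_le_exp; lra. }
assert (Hexp1 : 1 <= exp (c / 2)) by (assert (H := exp_ineq1_le (c / 2)); lra).
assert (HBC : 0 <= B * C) by (apply Rmult_le_pos; lra).
assert (HE : B * C <= E) by (unfold E; nra).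
assert (Hmain : psum (fun k => power_step a p (K + k) * (C * s (K + k)%nat ^ 2)) N <=
   g (K + N)%nat * (C * s (K + N)%nat ^ 2) + 2 * E * (s K - s (K + N)%nat)).
{ induction N as [|N IH].
  - cbn [psum]; rewrite Nat.add_0_r.
    assert (0 <= g K * (C * s K ^ 2)); [|lra].
    apply Rmult_le_pos; [apply rpow_ge_0 | apply Rmult_le_pos; [exact HC | apply pow2_ge_0]].
  - cbn [psum]; rewrite Nat.add_succ_r; set (j := (K + N)%nat) in *.
    unfold power_step at 2; fold (g (S j)) (g j).
    (* Factoring s_j^2 - s_(j+1)^2 leaves [s j - s (S j)], which telescopes, times a factor bounded
       by [2 * E]. *)
    enough (g (S j) * (C * s j ^ 2 - C * s (S j) ^ 2) <= 2 * E * (s j - s (S j))) by lra.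
    destruct (Hss j) as [Hs1 Hs2].
    assert (HgsC : C * (g (S j) * s j) <= E).
    { apply Rle_trans with (C * (exp (c / 2) * (g (S j) * s (S j)))).
      - apply Rmult_le_compat_l; [exact HC|].
        replace (exp (c / 2) * (g (S j) * s (S j))) with (g (S j) * (exp (c / 2) * s (S j))) by ring.
        apply Rmult_le_compat_l; [apply rpow_ge_0 | exact Hs1].
      - unfold E; replace (B * C * exp (c / 2)) with (C * (exp (c / 2) * B)) by ring.
        apply Rmult_le_compat_l; [exact HC|]; apply Rmult_le_compat_l; [lra | apply Hgs]. }
    replace (g (S j) * (C * s j ^ 2 - C * s (S j) ^ 2))
      with (C * (g (S j) * (s j + s (S j))) * (s j - s (S j))) by ring.
    apply Rmult_le_compat_r; [lra|].
    assert (Hcg : 0 <= C * g (S j)) by (apply Rmult_le_pos; [exact HC | apply rpow_ge_0]).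
    assert (C * g (S j) * s (S j) <= C * g (S j) * s j) by (apply Rmult_le_compat_l; lra).
    lra. }
apply Rle_trans with (psum (fun k => power_step a p (K + k) * (C * s (K + k)%nat ^ 2)) N).
{ apply psum_le; intros k _; apply Rmult_le_compat_l;
    [apply power_step_ge_0; lra | rewrite <- Hsq; apply Hq]. }
eapply Rle_trans; [exact Hmain|].
assert (Hlast : g (K + N)%nat * (C * s (K + N)%nat ^ 2) <= E * s (K + N)%nat).
{ replace (g (K + N)%nat * (C * s (K + N)%nat ^ 2))
    with (C * (g (K + N)%nat * s (K + N)%nat) * s (K + N)%nat) by ring.
  apply Rmult_le_compat_r; [apply Rlt_le, Hs0|].
  apply Rle_trans with (C * B); [apply Rmult_le_compat_l; [exact HC | apply Hgs] | lra]. }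
assert (HEs : 0 <= E * s (K + N)%nat) by (apply Rmult_le_pos; [lra | apply Rlt_le, Hs0]).
fold (s K); lra.
Qed.

(** * Moments from convergence and domination of survival functions *)

Section MomentLimit.
Variables (q : nat -> nat -> R) (a : nat -> R) (C c : R).
Hypothesis C_ge_0 : 0 <= C.
Hypothesis c_gt_0 : 0 < c.
Hypothesis a_lim : is_lim_seq a p_infty.
Hypothesis q_tail_bound : eventually (fun n => forall k, q n k <= C * exp (- (c * (INR k / a n)))).
Hypothesis q_shape : eventually (fun n =>
  (forall k, 0 <= q n k <= 1) /\ (forall i k, (i <= k)%nat -> q n k <= q n i) /\
  (forall k, (n < k)%nat -> q n k = 0)).
Hypothesis q_lim : forall (x : R) (k : nat -> nat), 0 < x ->
  is_lim_seq (fun n => INR (k n) / a n) x -> is_lim_seq (fun n => q n (k n)) (gauss x).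

Lemma a_large (A : R) : eventually (fun n => A < a n).
Proof. apply is_lim_seq_spec in a_lim; apply a_lim. Qed.

Lemma q_lim_floor (x e : R) : 0 < x -> 0 < e ->
  eventually (fun n => Rabs (q n (nat_floor (x * a n)) - gauss x) < e).
Proof.
intros Hx He.
assert (H : is_lim_seq (fun n => q n (nat_floor (x * a n))) (gauss x)).
{ apply q_lim; [exact Hx|].
  apply is_lim_seq_le_le_loc with (u := fun n => x - / a n) (w := fun _ => x).
  - generalize (a_large 0); apply filter_imp; intros n Ha.
    assert (Hxa : 0 <= x * a n) by (apply Rmult_le_pos; lra).
    destruct (nat_floor_spec _ Hxa) as [H1 H2].
    assert (Hm : INR (nat_floor (x * a n)) / a n * a n = INR (nat_floor (x * a n)))
      by (field; lra).
    assert (Hxm : (x - / a n) * a n = x * a n - 1) by (field; lra).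
    split; apply Rmult_le_reg_r with (a n); lra.
  - replace (Finite x) with (Finite (x - 0)) by (f_equal; ring).
    apply is_lim_seq_minus'; [apply is_lim_seq_const|].
    apply (is_lim_seq_inv _ p_infty); [exact a_lim | discriminate].
  - apply is_lim_seq_const. }
apply is_lim_seq_spec in H; apply (H (mkposreal e He)).
Qed.

(* Polya: monotonicity upgrades pointwise convergence to uniform convergence on compacts. *)
Lemma q_lim_uniform (T e : R) : 0 < T -> 0 < e ->
  eventually (fun n => forall k, INR k <= T * a n ->
    Rabs (q n k - gauss (INR k / a n)) <= e).
Proof.
(* Half of [e] is for the error at grid points, half for the variation of [gauss] over a mesh cell,
   as its Lipschitz constant is 1. *)
intros HT He; set (dl := e / 2); assert (Hdl : 0 < dl) by (unfold dl; lra).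
assert (Hgrid : forall m, eventually (fun n => forall i, (0 < i <= m)%nat ->
  Rabs (q n (nat_floor (INR i * dl * a n)) - gauss (INR i * dl)) < dl)).
{ induction m as [|m IH]; [apply filter_forall; intros n i Hi; lia|].
  assert (Hpos : 0 < INR (S m) * dl) by (apply Rmult_lt_0_compat; [apply lt_0_INR; lia | lra]).
  generalize (filter_and _ _ IH (q_lim_floor _ _ Hpos Hdl)).
  apply filter_imp; intros n [H1 H2] i Hi.
  destruct (Nat.eq_dec i (S m)) as [-> |]; [exact H2 | apply H1; lia]. }
assert (HTd : 0 <= T / dl) by (apply Rdiv_le_0_compat; lra).
(* One extra grid point, so that the right end of the last cell is covered. *)
set (m := S (nat_floor (T / dl))).
generalize (filter_and _ _ (Hgrid m) (filter_and _ _ q_shape (a_large 0))).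
apply filter_imp; intros n (Hg & (H01 & Hdecr & _) & Ha) k Hk.
set (x := INR k / a n).
assert (Hx : 0 <= x) by (apply Rdiv_le_0_compat; [apply pos_INR | exact Ha]).
assert (HxT : x <= T) by (apply Rmult_le_reg_r with (a n); [exact Ha|];
  unfold x; field_simplify; lra).
assert (Hkx : INR k = x * a n) by (unfold x; field; lra).
assert (Hxd : 0 <= x / dl) by (apply Rdiv_le_0_compat; lra).
set (i := nat_floor (x / dl)).
destruct (nat_floor_spec _ Hxd) as [Hi1 Hi2]; fold i in Hi1, Hi2.
assert (Him : (i < m)%nat).
{ unfold m; apply Nat.lt_succ_r, INR_le.
  destruct (nat_floor_spec _ HTd) as [Ht1 Ht2].
  assert (x / dl <= T / dl)
    by (apply Rmult_le_compat_r; [apply Rlt_le, Rinv_0_lt_compat; lra | exact HxT]).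
  apply Rlt_le in Hi2; apply Rnot_lt_le; intros Hlt; apply INR_lt, le_INR in Hlt.
  rewrite S_INR in Hlt; lra. }
assert (Hid : INR i * dl <= x < INR i * dl + dl).
{ replace x with (x / dl * dl) by (field; lra); split;
  [|replace (INR i * dl + dl) with ((INR i + 1) * dl) by ring].
  - apply Rmult_le_compat_r; lra.
  - apply Rmult_lt_compat_r; lra. }
assert (Hlow : gauss x - e <= q n k).
{ assert (H := Hg (S i) ltac:(lia)); apply Rabs_def2 in H.
  rewrite S_INR in H; set (x1 := (INR i + 1) * dl) in *.
  assert (Hx1 : 0 <= x <= x1) by (unfold x1; lra).
  assert (Hlip := gauss_lipschitz _ _ Hx1).
  assert (Hx1a : 0 <= x1 * a n) by (apply Rmult_le_pos; lra).
  assert (Hk' : (k <= nat_floor (x1 * a n))%nat).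
  { destruct (nat_floor_spec _ Hx1a) as [_ H2].
    apply Nat.lt_succ_r, INR_lt; rewrite S_INR, Hkx.
    apply Rle_lt_trans with (2 := H2), Rmult_le_compat_r; lra. }
  assert (Hq := Hdecr _ _ Hk'); unfold x1, dl in *; lra. }
assert (Hup : q n k <= gauss x + e).
(* In the first cell the left end is 0, where [q_lim] says nothing; the bound [q n k <= 1 = gauss 0]
   replaces it. *)
{ destruct (Nat.eq_dec i 0) as [Hi0|Hi0].
  - rewrite Hi0 in Hid; simpl in Hid.
    assert (Hlip := gauss_lipschitz 0 x ltac:(lra)); rewrite gauss_0 in Hlip.
    destruct (H01 k); unfold dl in *; lra.
  - assert (H := Hg i ltac:(lia)); apply Rabs_def2 in H.
    assert (Hi0' : 0 <= INR i * dl) by (apply Rmult_le_pos; [apply pos_INR | lra]).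
    assert (Hlip := gauss_lipschitz (INR i * dl) x ltac:(lra)).
    assert (Hia : 0 <= INR i * dl * a n) by (apply Rmult_le_pos; lra).
    assert (Hk' : (nat_floor (INR i * dl * a n) <= k)%nat).
    { destruct (nat_floor_spec _ Hia) as [H1 _].
      apply INR_le; rewrite Hkx; apply (Rle_trans _ _ _ H1), Rmult_le_compat_r; lra. }
    assert (Hq := Hdecr _ _ Hk'); unfold dl in *; lra. }
apply Rabs_le; lra.
Qed.

(** The sum is cut at an index [K] near [T * a n]. Below it [q] is replaced by [gauss], at a cost
    controlled by the telescoped total weight, and [power_step_gauss] applies; above it [psum_tail]
    makes the rest small, uniformly in [n]. *)
Lemma moment_limit (p l : R) : 0 < p -> is_lim (partial_moment p) p_infty l ->
  is_lim_seq (fun n => psum (fun k => power_step (a n) p k * q n k) (S n)) l.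
Proof.
intros Hp Hl; apply is_lim_seq_spec; intros [e0 He0].
change (eventually (fun n =>
  Rabs (psum (fun k => power_step (a n) p k * q n k) (S n) - l) < e0)).
(* Five errors of size at most [e] arise: replacing [q], the Stieltjes sum, the boundary term, the
   truncated moment and the tail. A sixth share leaves strict room. *)
set (e := e0 / 6); assert (He : 0 < e) by (unfold e; lra).
destruct (rpow_exp p (c / 2) Hp ltac:(lra)) as (B & HB & Hgrowth).
set (E := B * C * exp (c / 2)).
assert (HT : Rbar_locally p_infty (fun T =>
  Rabs (partial_moment p T - l) < e /\ Rabs (rpow T p * gauss T - 0) < e /\
  Rabs (2 * E * exp (- (c / 2 * T)) - 0) < e)).
{ assert (L2 := rpow_gauss_limit p Hp).
  assert (L3 := is_lim_exp_decay (2 * E) (c / 2) ltac:(lra)).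
  apply is_lim_spec in Hl; apply is_lim_spec in L2; apply is_lim_spec in L3.
  generalize (filter_and _ _ (Hl (mkposreal e He))
    (filter_and _ _ (L2 (mkposreal e He)) (L3 (mkposreal e He)))).
  apply filter_imp; intros T H; exact H. }
destruct HT as [T0 HT0].
set (T := Rmax T0 0 + 1).
assert (HT0T : T0 < T /\ 1 <= T)
  by (unfold T; split; [assert (H := Rmax_l T0 0) | assert (H := Rmax_r T0 0)]; lra).
set (G := rpow (T + 1) p).
assert (HG : 0 <= G) by apply rpow_ge_0.
assert (HeG : 0 < e / (G + 1)) by (apply Rdiv_lt_0_compat; lra).
assert (HT1 : 0 < T + 1) by lra.
generalize (filter_and _ _ (q_lim_uniform (T + 1) _ HT1 HeG)
  (filter_and _ _ q_shape (filter_and _ _ q_tail_bound (a_large (Rmax 1 (G / e)))))).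
apply filter_imp; intros n (Hunif & (H01 & _ & Hzero) & Htail & Ha).
assert (Ha1 : 1 < a n) by (assert (H := Rmax_l 1 (G / e)); lra).
assert (HaG : G / a n <= e).
{ assert (H : G / e <= a n) by (assert (H := Rmax_r 1 (G / e)); lra).
  apply Rmult_le_reg_r with (a n); [lra|].
  apply (Rmult_le_compat_r e) in H; [|lra].
  unfold Rdiv in *; rewrite Rmult_assoc, Rinv_l in H by lra.
  rewrite Rmult_assoc, Rinv_l by lra; lra. }
set (K := S (nat_floor (T * a n))).
assert (HTa : 0 <= T * a n) by (apply Rmult_le_pos; lra).
assert (HKT : T <= INR K / a n <= T + 1).
{ destruct (nat_floor_spec _ HTa) as [H1 H2]; unfold K; rewrite S_INR.
  split; apply Rmult_le_reg_r with (a n); try lra; field_simplify; lra. }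
set (g := power_step (a n) p).
assert (Hg : forall k, 0 <= g k) by (intros; apply power_step_ge_0; lra).
(* Since [q n] vanishes beyond [n], the range may be lengthened to [K + S n], which avoids comparing
   [K] with [n]. *)
assert (Hsplit : psum (fun k => g k * q n k) (S n) =
  psum (fun k => g k * q n k) K + psum (fun k => g (K + k)%nat * q n (K + k)%nat) (S n)).
{ rewrite <- psum_split, Nat.add_comm, psum_split.
  rewrite (psum_ext (fun k => g (S n + k)%nat * q n (S n + k)%nat) (fun _ => 0 - 0)).
  - rewrite (psum_telescope (fun _ => 0)); ring.
  - intros k _; rewrite Hzero by lia; ring. }
assert (HgK : rpow (INR K / a n) p <= G) by (apply rpow_le; lra).
assert (HgK0 := rpow_ge_0 (INR K / a n) p).
assert (Hdiff : Rabs (psum (fun k => g k * q n k) K -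
                      psum (fun k => g k * gauss (INR k / a n)) K) <= e).
{ assert (Hu : forall k, (k < K)%nat -> Rabs (q n k - gauss (INR k / a n)) <= e / (G + 1)).
  { intros k Hk; apply Hunif; apply lt_INR in Hk.
    apply Rle_trans with (INR K / a n * a n); [field_simplify; lra|].
    apply Rmult_le_compat_r; lra. }
  assert (Hsum : forall M, (M <= K)%nat ->
    Rabs (psum (fun k => g k * q n k) M - psum (fun k => g k * gauss (INR k / a n)) M)
    <= e / (G + 1) * psum g M).
  { induction M as [|M IH]; intros HM; simpl.
    - rewrite Rminus_0_r, Rabs_R0; lra.
    - replace (_ - _) with
        ((psum (fun k => g k * q n k) M - psum (fun k => g k * gauss (INR k / a n)) M) +
         g M * (q n M - gauss (INR M / a n))) by ring.
      eapply Rle_trans; [apply Rabs_triang|].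
      rewrite Rabs_mult, (Rabs_pos_eq (g M)) by apply Hg.
      assert (H1 := IH ltac:(lia)); assert (H2 := Hu M ltac:(lia)); assert (H3 := Hg M).
      apply (Rmult_le_compat_l (g M)) in H2; [lra | exact H3]. }
  eapply Rle_trans; [apply Hsum, le_n|].
  unfold g; rewrite (psum_power_step (a n) p K).
  apply Rle_trans with (e / (G + 1) * (G + 1)); [|right; field; lra].
  apply Rmult_le_compat_l; lra. }
assert (Hgauss := power_step_gauss (a n) p K ltac:(lra) Hp); fold g in Hgauss.
assert (Hga : rpow (INR K / a n) p / a n <= e).
{ apply Rle_trans with (2 := HaG), Rmult_le_compat_r;
    [apply Rlt_le, Rinv_0_lt_compat; lra | exact HgK]. }
destruct (HT0 (INR K / a n) ltac:(lra)) as (HJ & Hgh & Hexp).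
assert (Htl := psum_tail (a n) c C B p (q n) K (S n) ltac:(lra) c_gt_0 C_ge_0 HB ltac:(lra)
                  Hgrowth Htail).
fold E in Htl.
assert (Htl0 : 0 <= psum (fun k => g (K + k)%nat * q n (K + k)%nat) (S n)).
{ apply Rle_trans with (psum (fun _ => 0 - 0) (S n)).
  - rewrite (psum_telescope (fun _ => 0)); lra.
  - apply psum_le; intros k _; rewrite Rminus_0_r; apply Rmult_le_pos; [apply Hg | apply H01]. }
fold g in Htl; rewrite Hsplit.
apply Rabs_le_between in Hdiff; apply Rabs_le_between in Hgauss.
apply Rabs_def2 in HJ; apply Rabs_def2 in Hgh; apply Rabs_def2 in Hexp.
unfold g in *; apply Rabs_def1; unfold e in *; lra.
Qed.

End MomentLimit.

Lemma expect_scal (n : nat) (dn : nat -> nat) (v : nat) (c : R) (f g : nat -> R) :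
  (forall s, f s = c * g s) -> expect_s n dn v f = c * expect_s n dn v g.
Proof.
intros H; unfold expect_s, Rdiv; rewrite <- Rmult_assoc; f_equal.
unfold rsum; induction (Fd n dn) as [|x l IHl]; cbn [map fold_right]; [ring|].
rewrite IHl, H; ring.
Qed.

(** Three terms of the Leibniz series give PI / 4 <= 13 / 15. Strictness keeps the factor [4 - PI]
    of the variance away from 0. *)
Lemma PI_lt_4 : PI < 4.
Proof.
assert (H := proj2 (PI_ineq 1)).
unfold tg_alt, PI_tg in H; simpl in H; lra.
Qed.

Lemma ln_ge_1 (n : nat) : (3 <= n)%nat -> 1 <= ln (INR n).
Proof.
intros Hn; apply le_INR in Hn; simpl in Hn.
rewrite <- (ln_exp 1); apply ln_le; [apply exp_pos|].
assert (H := exp_le_3); lra.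
Qed.

(** For [n >= 3] the logarithm is at least 1, so a bound by [x / ln n ^ 3] yields one by [x]. *)
Lemma div_ln_bounds (x : R) (n : nat) : (3 <= n)%nat -> 0 <= x -> 0 <= x / ln (INR n) ^ 3 <= x.
Proof.
intros Hn Hx; assert (Hln := pow_R1_Rle _ 3 (ln_ge_1 n Hn)).
split; [apply Rdiv_le_0_compat; lra|].
apply Rmult_le_reg_r with (ln (INR n) ^ 3); [lra|].
unfold Rdiv; rewrite Rmult_assoc, Rinv_l; nra.
Qed.

Section Moments.
Variables (d : nat -> nat -> nat) (v : nat -> nat).
Hypothesis Hd : forall n, (1 <= n)%nat -> is_degree_sequence n (d n).
Hypothesis Hv : forall n, (1 <= n)%nat -> (v n < n)%nat.
Hypothesis H1 : little_o (fun n => sigma2 n (d n)) (fun n => INR n / (ln (INR n)) ^ 3).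
Hypothesis H2 : little_o (fun n => / INR n) (fun n => sigma2 n (d n)).
Hypothesis H3 : little_o (fun n => INR (maxdeg n (d n)))
                 (fun n => sqrt (INR n * sigma2 n (d n) / (ln (INR n)) ^ 3)).

Let a n := sqrt (INR n / sigma2 n (d n)).
Let r n := sqrt (INR n * sigma2 n (d n)).

(** As [sigma2] is nonnegative and dominates a positive sequence, the lower growth hypothesis also
    makes it eventually positive, so the later divisions are legitimate. *)
Lemma inv_n_le_sigma2 (e : R) : 0 < e ->
  eventually (fun n => (3 <= n)%nat /\ 0 < sigma2 n (d n) /\ / INR n <= e * sigma2 n (d n)).
Proof.
intros He; destruct (H2 e He) as [N HN]; exists (max N 3); intros n Hn.
assert (Hn0 : 0 < / INR n) by (apply Rinv_0_lt_compat, lt_0_INR; lia).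
assert (Hs := sigma2_ge_0 n (d n) (v n) (Hd n ltac:(lia)) (Hv n ltac:(lia))).
assert (H := HN n ltac:(lia)); rewrite (Rabs_pos_eq (/ INR n)), Rabs_pos_eq in H by lra.
repeat split; [lia | nra | exact H].
Qed.

Lemma sigma2_good :
  eventually (fun n => is_degree_sequence n (d n) /\ (v n < n)%nat /\ 0 < sigma2 n (d n)).
Proof.
generalize (inv_n_le_sigma2 1 Rlt_0_1); apply filter_imp; intros n (Hn & Hs & _).
repeat split; [apply Hd; lia | apply Hv; lia | exact Hs].
Qed.

Lemma root_infinite : is_lim_seq r p_infty.
Proof.
apply is_lim_seq_spec; intros A.
assert (HA : 0 < / (A ^ 2 + 1)) by (apply Rinv_0_lt_compat; assert (H := pow2_ge_0 A); lra).
generalize (inv_n_le_sigma2 _ HA); apply filter_imp; intros n (Hn & Hs & H).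
assert (Hn0 : 0 < INR n) by (apply lt_0_INR; lia).
assert (HM : A ^ 2 + 1 <= INR n * sigma2 n (d n)).
{ apply (Rmult_le_compat_l (INR n * (A ^ 2 + 1))) in H.
  - field_simplify in H; try lra; assert (H' := pow2_ge_0 A); lra.
  - assert (H' := pow2_ge_0 A); nra. }
apply Rle_lt_trans with (Rabs A); [apply Rle_abs|].
rewrite <- sqrt_Rsqr_abs; apply sqrt_lt_1; unfold Rsqr; nra.
Qed.

Lemma scale_infinite : is_lim_seq a p_infty.
Proof.
apply is_lim_seq_spec; intros A.
assert (HA : 0 < / (A ^ 2 + 1)) by (apply Rinv_0_lt_compat; assert (H := pow2_ge_0 A); lra).
destruct (H1 _ HA) as [N HN].
destruct (inv_n_le_sigma2 1 Rlt_0_1) as [N' HN'].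
exists (max N N'); intros n Hn; destruct (HN' n ltac:(lia)) as (Hn3 & Hs & _).
assert (Hn0 : 0 < INR n) by (apply lt_0_INR; lia).
assert (H := HN n ltac:(lia)); destruct (div_ln_bounds (INR n) n Hn3 ltac:(lra)) as [Hl1 Hl2].
rewrite !Rabs_pos_eq in H by lra.
assert (HM : A ^ 2 + 1 <= INR n / sigma2 n (d n)).
{ apply Rmult_le_reg_r with (sigma2 n (d n)); [exact Hs|].
  unfold Rdiv at 1; rewrite Rmult_assoc, Rinv_l by lra.
  assert (H' := pow2_ge_0 A).
  apply Rmult_le_reg_l with (/ (A ^ 2 + 1)); [exact HA|].
  rewrite <- Rmult_assoc, Rinv_l, Rmult_1_l, Rmult_1_r by lra.
  apply (Rle_trans _ _ _ H), Rmult_le_compat_l; lra. }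
apply Rle_lt_trans with (Rabs A); [apply Rle_abs|].
rewrite <- sqrt_Rsqr_abs; apply sqrt_lt_1; unfold Rsqr; nra.
Qed.

Lemma maxdeg_root : is_lim_seq (fun n => INR (maxdeg n (d n)) / r n) 0.
Proof.
apply is_lim_seq_spec; intros [e He].
destruct (H3 (e / 2) ltac:(lra)) as [N HN].
destruct (inv_n_le_sigma2 1 Rlt_0_1) as [N' HN'].
exists (max N N'); intros n Hn; destruct (HN' n ltac:(lia)) as (Hn3 & Hs & _).
assert (Hn0 : 0 < INR n) by (apply lt_0_INR; lia).
assert (Hr : 0 < r n) by (apply sqrt_lt_R0, Rmult_lt_0_compat; lra).
assert (HM : 0 <= INR n * sigma2 n (d n)) by (apply Rmult_le_pos; lra).
assert (H := HN n ltac:(lia)); destruct (div_ln_bounds _ n Hn3 HM) as [Hl1 Hl2].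
rewrite (Rabs_pos_eq (INR _)), Rabs_pos_eq in H by (apply sqrt_pos || apply pos_INR).
apply sqrt_le_1 in Hl2; [|lra|lra]; fold (r n) in Hl2.
simpl; rewrite Rminus_0_r, Rabs_pos_eq by (apply Rdiv_le_0_compat; [apply pos_INR | exact Hr]).
apply Rmult_lt_reg_r with (r n); [exact Hr|].
unfold Rdiv; rewrite Rmult_assoc, Rinv_l by lra.
apply (Rmult_le_compat_l (e / 2)) in Hl2; [|lra]; nra.
Qed.

Lemma expect_moment_limit (p l : R) : 0 < p -> is_lim (partial_moment p) p_infty l ->
  is_lim_seq (fun n => expect_s n (d n) (v n) (fun s => rpow (INR s / a n) p)) l.
Proof.
intros Hp Hl.
assert (Hlim := moment_limit (fun n => survival n (d n) (v n)) a (2 * exp (1 / 4)) (1 / 8)).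
apply is_lim_seq_ext_loc with
  (fun n => psum (fun k => power_step (a n) p k * survival n (d n) (v n) k) (S n)).
- generalize sigma2_good; apply filter_imp; intros n (Hdn & Hvn & _).
  rewrite (expect_survival n (d n) (v n) Hdn Hvn _ (S n)) by lia.
  replace (INR 0 / a n) with 0 by (simpl; unfold Rdiv; ring).
  rewrite rpow_0, Rplus_0_l; reflexivity.
- apply Hlim; try assumption.
  + assert (H := exp_pos (1 / 4)); lra.
  + lra.
  + apply scale_infinite.
  + assert (HD := maxdeg_root); apply is_lim_seq_spec in HD.
    (* A ratio of maximal degree to [r n] below 1/2 gives the condition [2 * D ^ 2 <= r ^ 2] of
       [survival_tail]. *)
    assert (Hhalf : 0 < / 2) by lra.
    generalize (filter_and _ _ sigma2_good (HD (mkposreal _ Hhalf))).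
    apply filter_imp; intros n [(Hdn & Hvn & Hs) Hn] k.
    assert (Hr := root_pos n (d n) (v n) Hvn Hs); fold (r n) in Hr.
    assert (Ha := scale_pos n (d n) (v n) Hvn Hs); fold (a n) in Ha.
    replace (1 / 8 * (INR k / a n)) with (INR k / (8 * a n)) by (field; lra).
    apply survival_tail; try assumption; fold (r n).
    simpl in Hn; rewrite Rminus_0_r in Hn.
    assert (H0 := pos_INR (maxdeg n (d n))).
    rewrite Rabs_pos_eq in Hn by (apply Rdiv_le_0_compat; lra).
    apply (Rmult_lt_compat_r (r n)) in Hn; [|exact Hr].
    unfold Rdiv in Hn; rewrite Rmult_assoc, Rinv_l in Hn by lra; nra.
  + generalize sigma2_good; apply filter_imp; intros n (Hdn & Hvn & _); repeat split.
    * now apply survival_01.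
    * now apply survival_01.
    * intros; now apply survival_decr.
    * intros; now apply survival_big.
  + intros x k Hx Hk; apply survival_limit; try assumption.
    * apply sigma2_good.
    * apply scale_infinite.
    * apply root_infinite.
    * apply maxdeg_root.
Qed.

Lemma expect_INR_limit : is_lim_seq (fun n => expect_s n (d n) (v n) INR / a n) (sqrt (PI / 2)).
Proof.
assert (H := expect_moment_limit 1 _ Rlt_0_1 partial_moment_1).
revert H; apply is_lim_seq_ext_loc; generalize sigma2_good; apply filter_imp.
intros n (_ & Hvn & Hs); assert (Ha := scale_pos n (d n) (v n) Hvn Hs); fold (a n) in Ha.
rewrite (expect_scal _ _ _ (/ a n) _ INR); [unfold Rdiv; ring|].
intros s; rewrite rpow_1; [unfold Rdiv; ring|].
apply Rdiv_le_0_compat; [apply pos_INR | exact Ha].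
Qed.

Lemma expect_square_limit :
  is_lim_seq (fun n => expect_s n (d n) (v n) (fun s => INR s ^ 2) / a n ^ 2) 2.
Proof.
assert (H := expect_moment_limit 2 _ Rlt_0_2 partial_moment_2).
revert H; apply is_lim_seq_ext_loc; generalize sigma2_good; apply filter_imp.
intros n (_ & Hvn & Hs); assert (Ha := scale_pos n (d n) (v n) Hvn Hs); fold (a n) in Ha.
rewrite (expect_scal _ _ _ (/ a n ^ 2) _ (fun s => INR s ^ 2)); [unfold Rdiv; ring|].
intros s; rewrite rpow_2; [field; lra|].
apply Rdiv_le_0_compat; [apply pos_INR | exact Ha].
Qed.

Lemma scale_square (n : nat) : (v n < n)%nat -> 0 < sigma2 n (d n) ->
  INR n / sigma2 n (d n) = a n ^ 2.
Proof.
intros Hvn Hs; unfold a; rewrite pow2_sqrt; [reflexivity|].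
apply Rdiv_le_0_compat; [apply pos_INR | exact Hs].
Qed.

End Moments.

Theorem theorem2p2 (d : nat -> nat -> nat) (v : nat -> nat)
  (Hd : forall n, (1 <= n)%nat -> is_degree_sequence n (d n))
  (Hv : forall n, (1 <= n)%nat -> (v n < n)%nat)
  (H1 : little_o (fun n => sigma2 n (d n)) (fun n => INR n / (ln (INR n)) ^ 3))
  (H2 : little_o (fun n => / INR n) (fun n => sigma2 n (d n)))
  (H3 : little_o (fun n => INR (maxdeg n (d n)))
                 (fun n => sqrt (INR n * sigma2 n (d n) / (ln (INR n)) ^ 3))) :
  (forall p : R, 1 <= p ->
     exists l : R, rayleigh_moment p l /\
       Un_cv (fun n => expect_s n (d n) (v n)
                 (fun s => rpow (INR s / sqrt (INR n / sigma2 n (d n))) p)) l)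
  /\
  Un_cv (fun n => expect_s n (d n) (v n) INR
                  / sqrt (PI * INR n / (2 * sigma2 n (d n)))) 1
  /\
  Un_cv (fun n => (expect_s n (d n) (v n) (fun s => INR s ^ 2)
                   - (expect_s n (d n) (v n) INR) ^ 2)
                  / ((4 - PI) * INR n / (2 * sigma2 n (d n)))) 1.
Proof.
assert (Hgood := sigma2_good d v Hd Hv H2).
assert (HPI := PI_RGT_0); assert (HPI4 := PI_lt_4).
assert (Hsqrt : 0 < sqrt (PI / 2)) by (apply sqrt_lt_R0; lra).
assert (Hmean := expect_INR_limit d v Hd Hv H1 H2 H3).
split; [|split].
- intros p Hp; destruct (partial_moment_limit p ltac:(lra)) as [l Hl].
  exists l; split; [apply rayleigh_moment_limit; [lra | exact Hl]|].
  apply is_lim_seq_Reals, expect_moment_limit; try assumption; lra.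
- apply is_lim_seq_Reals.
  replace (Finite 1) with (Finite (sqrt (PI / 2) / sqrt (PI / 2))) by (f_equal; field; lra).
  assert (H := is_lim_seq_div' _ _ _ _ Hmean (is_lim_seq_const (sqrt (PI / 2))) ltac:(lra)).
  revert H; apply is_lim_seq_ext_loc; revert Hgood; apply filter_imp.
  intros n (_ & Hvn & Hs); assert (Ha := scale_pos n (d n) (v n) Hvn Hs).
  replace (PI * INR n / (2 * sigma2 n (d n))) with (PI / 2 * (INR n / sigma2 n (d n)))
    by (field; lra).
  rewrite sqrt_mult_alt by lra; field; split; lra.
- apply is_lim_seq_Reals.
  assert (Hsq := expect_square_limit d v Hd Hv H1 H2 H3).
  (* In units of the squared scale the variance tends to 2 - PI / 2, which is exactly (4 - PI) /
     2. *)
  replace (Finite 1) with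
    (Finite ((2 - sqrt (PI / 2) * sqrt (PI / 2)) / ((4 - PI) / 2)))
    by (rewrite sqrt_sqrt by lra; f_equal; field; lra).
  assert (H := is_lim_seq_div' _ _ _ _
    (is_lim_seq_minus' _ _ _ _ Hsq (is_lim_seq_mult' _ _ _ _ Hmean Hmean))
    (is_lim_seq_const ((4 - PI) / 2)) ltac:(lra)).
  revert H; apply is_lim_seq_ext_loc; revert Hgood; apply filter_imp.
  intros n (_ & Hvn & Hs); assert (Ha := scale_pos n (d n) (v n) Hvn Hs).
  replace ((4 - PI) * INR n / (2 * sigma2 n (d n)))
    with ((4 - PI) / 2 * sqrt (INR n / sigma2 n (d n)) ^ 2)
    by (rewrite <- (scale_square d v n Hvn Hs); field; lra).
  field; split; lra.
Qed.
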